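(* Let $d \in \mathbb{N}$ and $\alpha > -1$. Then, for all $n\in\mathbb{N}_0$, $$\mathcal{V}^{\alpha,1}_n = \begin{cases} \mathcal{V}^\alpha_n & \text{if } n \leq 2,\\ \mathcal{H}^d_n \oplus_{\alpha,1} M^\alpha(\mathcal{V}^{\alpha+1}_{n-2}) & \text{if } n \geq 3, \end{cases}$$ where $\oplus_{\alpha,1}$ denotes a direct sum that is orthogonal with respect to $\langle\cdot,\cdot\rangle_{\alpha,1}$.
   Context: $\mathbb{N}$ is the set of positive integers and $\mathbb{N}_0=\mathbb{N}\cup\{0\}$. $\lVert\cdot\rVert$ is the Euclidean norm, $B^d$ is the open unit ball of $\mathbb{R}^d$. Functions are complex-valued. For $\alpha>-1$, $\langle u,v\rangle_\alpha=\int_{B^d}u\,\overline{v}\,(1-\lVert x\rVert^2)^\alpha\,dx$ (also for vector-valued functions, summing over components). $\Pi^d_n$ is the space of $d$-variate polynomials of total degree at most $n$, with $\Pi^d_n=\{0\}$ for $n<0$. For $n\in\mathbb{N}_0$, $\mathcal{V}^\alpha_n=\{p\in\Pi^d_n: \langle p,q\rangle_\alpha=0\ \forall q\in\Pi^d_{n-1}\}$. Let $\langle u,v\rangle_{\alpha,1}=\langle\nabla u,\nabla v\rangle_\alpha+c_\alpha^{-1}\langle u,1\rangle_\alpha\overline{\langle v,1\rangle_\alpha}$ with $c_\alpha=\langle1,1\rangle_\alpha$, and $\mathcal{V}^{\alpha,1}_n=\{p\in\Pi^d_n: \langle p,q\rangle_{\alpha,1}=0\ \forall q\in\Pi^d_{n-1}\}$.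 $\mathcal{H}^d_n$ is the space of $d$-variate harmonic homogeneous polynomials of degree $n$. $M^\alpha$ is the second-order differential operator $M^\alpha(u)(x)=(1-\lVert x\rVert^2)^{1-\alpha}\,\Delta\big((1-\lVert x\rVert^2)^{1+\alpha}u(x)\big)$, which maps polynomials to polynomials. *)

(* Defs.v *)
From HB Require Import structures.
From mathcomp Require Import all_boot all_order all_algebra.
(* The notations of mpoly, and its constant isMeasure, clash with those of
   MathComp-Analysis. *)
From mathcomp Require Import -(notations) mpoly.
From mathcomp Require Import all_classical all_reals all_analysis.
From mathcomp Require Import complex.

Set Implicit Arguments.
Unset Strict Implicit.
Unset Printing Implicit Defensive.

Import Order.TTheory GRing.Theory Num.Theory.
Import numFieldNormedType.Exports.

Local Open Scope classical_set_scope.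
Local Open Scope ring_scope.
Local Open Scope complex_scope.

Section LebesgueMeasure.
Context {R : realType}.
Local Notation mR := (measurableTypeR R).

Definition tcons n (xy : mR * n.-tuple mR) : n.+1.-tuple mR :=
  [the n.+1.-tuple mR of xy.1 :: xy.2].

Lemma measurable_tcons n : measurable_fun [set: mR * n.-tuple mR] (@tcons n).
Proof. exact: measurable_cons. Qed.

Section Step.
Variables (m1 : {sigma_finite_measure set mR -> \bar R}) (n : nat).
Variable m : {sigma_finite_measure set (n.-tuple mR) -> \bar R}.

Definition cons_measure : set (n.+1.-tuple mR) -> \bar R :=
  pushforward (m1 \x m)%E (@tcons n).

Let step0 : cons_measure set0 = 0%E.
Proof. by rewrite /cons_measure /pushforward preimage_set0 measure0. Qed.

Let step_ge0 A : (0 <= cons_measure A)%E.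
Proof. exact: (measure_ge0 (m1 \x m)%E). Qed.

Let step_sigma_additive : semi_sigma_additive cons_measure.
Proof.
move=> F mF tF mUF.
have mc A : measurable A -> measurable (@tcons n @^-1` A).
  by move=> mA; rewrite -[X in measurable X]setTI; exact: measurable_tcons.
rewrite /cons_measure /pushforward preimage_bigcup.
apply: measure_semi_sigma_additive.
- by move=> k; exact: mc.
- apply/trivIsetP => /= i j _ _ ij; rewrite -preimage_setI.
  by move/trivIsetP : tF => /(_ _ _ _ _ ij) ->//; rewrite preimage_set0.
- by rewrite -preimage_bigcup; exact: mc.
Qed.

HB.instance Definition _ := isMeasure.Build _ _ _
  cons_measure step0 step_ge0 step_sigma_additive.

Let step_sigma_finite : sigma_finite setT cons_measure.
Proof.
have /sigma_finiteP[F [TF ndF Foo]] := sigma_finiteT m1.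
have /sigma_finiteP[G [TG ndG Goo]] := sigma_finiteT m.
pose uncons (t : n.+1.-tuple mR) : mR * n.-tuple mR :=
  (thead t, [tuple of behead t]).
have unconsK p : uncons (tcons p) = p.
  case: p => x y; rewrite /uncons /tcons /=; congr pair.
  by apply: val_inj.
have muncons : measurable_fun setT uncons.
  apply/measurable_fun_pairP; split; first exact: measurable_tnth.
  exact: measurable_behead.
exists (fun k => uncons @^-1` (F k `*` G k)).
  rewrite -preimage_bigcup (_ : \bigcup_k (F k `*` G k) = setT) ?preimage_setT//.
  rewrite -subTset => -[x y] _.
  have [i _ Fix] : (\bigcup_i F i) x by rewrite -TF.
  have [j _ Gjy] : (\bigcup_j G j) y by rewrite -TG.
  exists (maxn i j) => //; split.
  - by move: x Fix; exact/subsetPset/ndF/leq_maxl.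
  - by move: y Gjy; exact/subsetPset/ndG/leq_maxr.
move=> k; have [mFk Fk] := Foo k; have [mGk Gk] := Goo k; split.
  by rewrite -[X in measurable X]setTI; apply: muncons => //; exact: measurableX.
rewrite /cons_measure /pushforward -comp_preimage (_ : uncons \o _ = id).
  by rewrite product_measure1E// lte_mul_pinfty// ge0_fin_numE.
by apply/funext => p; exact: unconsK.
Qed.

HB.instance Definition _ := Measure_isSigmaFinite.Build _ _ _
  cons_measure step_sigma_finite.

End Step.

Definition dirac_nil : set (0.-tuple mR) -> \bar R := dirac [tuple].
HB.instance Definition _ := Measure.on dirac_nil.

Lemma dirac_nil_sigma_finite : sigma_finite setT dirac_nil.
Proof.
exists (fun=> setT); first by rewrite bigcup_const.
by move=> _; split=> //; rewrite /dirac_nil diracT ltry.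
Qed.

HB.instance Definition _ := Measure_isSigmaFinite.Build _ _ _
  dirac_nil dirac_nil_sigma_finite.

(* The Lebesgue measure of R^n, as the n-fold product of that of R. *)
Fixpoint lebesgue_tuple n : {sigma_finite_measure set (n.-tuple mR) -> \bar R} :=
  match n with
  | 0 => dirac_nil
  | n'.+1 => cons_measure (@lebesgue_measure R) (lebesgue_tuple n')
  end.
End LebesgueMeasure.

Section Definitions.
Context {R : realType} {d : nat}.
Local Notation poly := (mpoly.mpoly d R[i]).
Implicit Types (u v : 'rV[R]_d -> R[i]) (p q : poly) (alpha : R).

Definition rvec (t : d.-tuple (measurableTypeR R)) : 'rV[R]_d :=
  \row_i tnth t i.

(* Not [`|x|], which is the sup norm on matrices. *)
Definition enorm (x : 'rV[R]_d) : R := Num.sqrt (\sum_i x 0 i ^+ 2).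

Definition unit_ball : set 'rV[R]_d := [set x | enorm x < 1].

Definition integral_ball u : R[i] :=
  \int[lebesgue_tuple d]_(t in rvec @^-1` unit_ball) complex.Re (u (rvec t))
  +i* \int[lebesgue_tuple d]_(t in rvec @^-1` unit_ball) complex.Im (u (rvec t)).

Definition weight alpha (x : 'rV[R]_d) : R := (1 - enorm x ^+ 2) `^ alpha.

Definition inner alpha u v : R[i] :=
  integral_ball (fun x => u x * (v x)^* * (weight alpha x)%:C).

(* The library has no norm over R on R[i], so the derivative is taken on the
   real and imaginary parts. *)
Definition partial (i : 'I_d) u (x : 'rV[R]_d) : R[i] :=
  'D_(delta_mx 0 i) (fun y => complex.Re (u y)) x
  +i* 'D_(delta_mx 0 i) (fun y => complex.Im (u y)) x.

Definition laplacian u (x : 'rV[R]_d) : R[i] :=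
  \sum_(i < d) partial i (partial i u) x.

Definition one_fun : 'rV[R]_d -> R[i] := fun=> 1.

Definition inner1 alpha u v : R[i] :=
  \sum_(i < d) inner alpha (partial i u) (partial i v)
  + (inner alpha one_fun one_fun)^-1 * inner alpha u one_fun
    * (inner alpha v one_fun)^*.

Definition peval p (x : 'rV[R]_d) : R[i] :=
  mpoly.meval (fun i => (x 0 i)%:C) p.

(* [msize p] is the total degree plus one, and is 0 for [p = 0]. *)
Definition Pi (n : int) : set poly :=
  if n is Posz m then [set p : poly | (mpoly.msize p <= m.+1)%N] else [set 0].

Definition Vspace alpha (n : nat) : set poly :=
  [set p | Pi n p /\
    forall q, Pi (n%:Z - 1) q -> inner alpha (peval p) (peval q) = 0].

Definition Vspace1 alpha (n : nat) : set poly :=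
  [set p | Pi n p /\
    forall q, Pi (n%:Z - 1) q -> inner1 alpha (peval p) (peval q) = 0].

Definition Harm (n : nat) : set poly :=
  [set p | p \is mpoly.ishomog1 n mpoly.mdeg /\
    forall x, laplacian (peval p) x = 0].

Definition Mop alpha u (x : 'rV[R]_d) : R[i] :=
  (weight (1 - alpha) x)%:C
  * laplacian (fun y => (weight (1 + alpha) y)%:C * u y) x.

(* Over the unit ball, where its defining formula makes sense, [Mop alpha] maps
   polynomials to polynomials, and a polynomial is determined by its values
   there (for [0 < d]); this is the resulting image of [V]. *)
Definition Mimage alpha (V : set poly) : set poly :=
  [set q | exists2 p, V p &
    forall x, unit_ball x -> peval q x = Mop alpha (peval p) x].

Definition orthogonal_direct_sum alpha (W U V : set poly) : Prop :=
  [/\ W = [set p + q | p in U & q in V],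
      forall p p' q q', U p -> U p' -> V q -> V q' ->
        p + q = p' + q' -> p = p' /\ q = q'
    & forall p q, U p -> V q -> inner1 alpha (peval p) (peval q) = 0].

End Definitions.

(* Main.v *)
(* With [rho = 1 - |x|^2], the only analytic facts needed about
   [L p = int_B p rho^a] are positivity and the integration by parts rule
   [L (rho d_i p) = 2 (a + 1) L (x_i p)], valid for every [a > -1] because
   [rho^(a + 1) p] vanishes on the sphere. From this rule alone one gets, for all
   polynomials [u] and [q],
   [L (grad (M u) . grad q) = - L (rho u Lap (rho Lap q - 2 a x . grad q))] and
   [L (M u) = - 2 d L (rho u)], so [M] maps the orthogonal polynomials of degree
   [n - 2] for [rho^(a + 1)] into V^{a,1}_n; taking [q] harmonic and homogeneous
   makes the right-hand side vanish, which is the orthogonality of the sum.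
   Conversely, the top homogeneous part of a polynomial of degree [n] is
   [h + |x|^2 g] with [h] harmonic, and the top part of [M f] is
   [|x|^2 (|x|^2 Lap f + c f)] with [c > 0]; since [|x|^2 Lap + c] is onto on
   homogeneous polynomials, an element of V^{a,1}_n agrees with a sum [h + M u]
   up to terms of degree [< n], and then it is equal to it. *)
Require Import Defs.
From HB Require Import structures.
From mathcomp Require Import all_boot all_order all_algebra.
From mathcomp Require Import -(notations) mpoly.
From mathcomp Require Import all_classical all_reals all_analysis.
From mathcomp Require Import measurable_realfun complex ring lra.

Set Implicit Arguments.
Unset Strict Implicit.
Unset Printing Implicit Defensive.

Import Order.TTheory GRing.Theory Num.Theory.
Import numFieldNormedType.Exports.

Local Open Scope classical_set_scope.
Local Open Scope ring_scope.

(** * Integration by parts on polynomials *)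

Section BallAlgebra.
Context {C : numFieldType} {d : nat}.
Local Notation poly := (mpoly.mpoly d C).
Local Notation cst := (@mpoly.mpolyC d C).
Local Notation var i := (@mpoly.mpolyX d C (mpoly.mnm1 i)).
Implicit Types (p q f g u w : poly) (i j : 'I_d) (a c : C).

(** Formally, moving the gradient off [M u] and then moving the Laplacian off [rho^(a + 1) u] proves
    the gradient identity in two steps, but the intermediate integral carries [rho^(a - 1)], which
    is not integrable for [a <= 0]. The algebra therefore replaces [2 a] times the integral of
    [rho^(a - 1) p] by [L (euler p) + (d + 2 a) L p], which makes sense for every [a > -1].
    [ibp_euler_rho] and [ibp_div] are the rules for this substitute; with them the contribution of
    the part of [M u] not divisible by [rho] cancels exactly against that of the Euler term of
    [Tpoly q]. The functional [L] is kept abstract because the same rules are needed for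
    [rho_mul L], with [a + 1] in place of [a], in an induction on the degree. On the analytic side
    the singular weight returns: for [-1 < a < 0] the derivative of [rho^(a + 1) p] is unbounded
    near the sphere. The rule is thus proved on each line parallel to an axis, by the fundamental
    theorem on compact subintervals and a passage to the limit, and Fubini's theorem assembles the
    lines. *)

Definition normsq : poly := \sum_i var i * var i.
Definition rho : poly := 1 - normsq.
Definition lap p : poly := \sum_i mderiv i (mderiv i p).
Definition euler p : poly := \sum_i var i * mderiv i p.
Definition gradmul p q : poly := \sum_i mderiv i p * mderiv i q.

(* [rho ^ (s - 1) * wderiv s i p] is the [i]-th derivative of [rho ^ s * p]. *)
Definition wderiv (s : C) i p : poly := rho * mderiv i p - cst (2 * s) * (var i * p).

(** The two derivatives lower the exponent from [a + 1] to [a - 1], and the outer factor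
    [rho^(1 - a)] of [M] cancels what is left. *)
Definition Mpoly a p : poly := \sum_i wderiv a i (wderiv (a + 1) i p).

Lemma mderivXU i j : mderiv i (var j) = (i == j)%:R.
Proof.
rewrite mderivX mnm1E eq_sym; case: eqP => [->|_]; last by rewrite scale0r.
rewrite scale1r -[RHS]mpolyX0; congr mpolyX; apply/mnmP => k.
by rewrite mnmBE subnn mnm0E.
Qed.

Lemma mderiv_sum i (F : 'I_d -> poly) :
  mderiv i (\sum_j F j) = \sum_j mderiv i (F j).
Proof. by apply: (big_morph _ (mderivD i)); exact: mderiv0. Qed.

Lemma mderiv1 i : mderiv i (1 : poly) = 0.
Proof. by rewrite -(mpolyC1 d C) mderivC. Qed.

Lemma sum_deltar (F : 'I_d -> poly) i : \sum_j F j * (i == j)%:R = F i.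
Proof.
rewrite (bigD1 i) //= eqxx mulr1 big1 ?addr0 // => j ji.
by rewrite eq_sym (negbTE ji) mulr0.
Qed.

Lemma mderiv_normsq i : mderiv i normsq = var i *+ 2.
Proof.
rewrite /normsq mderiv_sum.
under eq_bigr do rewrite mderivM mderivXU mulrC -mulrDr.
rewrite -[RHS](sum_deltar (fun j => var j *+ 2)).
by apply: eq_bigr => j _; rewrite mulr2n !mulrDl !mulrDr.
Qed.

Lemma mderiv_rho i : mderiv i rho = - (var i *+ 2).
Proof. by rewrite /rho mderivB mderiv1 sub0r mderiv_normsq. Qed.

Lemma gradmul_rho p : gradmul rho p = - (euler p *+ 2).
Proof.
rewrite /gradmul /euler -sumrMnl -sumrN; apply: eq_bigr => i _.
by rewrite mderiv_rho mulNr mulrnAl.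
Qed.

Lemma eulerM p q : euler (p * q) = euler p * q + p * euler q.
Proof.
rewrite /euler mulr_suml mulr_sumr -big_split; apply: eq_bigr => i _ /=.
by rewrite mderivM; ring.
Qed.

Lemma euler_rho : euler rho = - (normsq *+ 2).
Proof.
rewrite /euler /normsq -sumrMnl -sumrN; apply: eq_bigr => i _.
by rewrite mderiv_rho mulrN mulrnAr.
Qed.

Lemma lapM p q : lap (p * q) = lap p * q + gradmul p q *+ 2 + p * lap q.
Proof.
rewrite /lap /gradmul mulr_suml mulr_sumr -sumrMnl -!big_split.
by apply: eq_bigr => i _ /=; rewrite !mderivM !mderivD !mderivM; ring.
Qed.

Lemma gradmulMl p q f : gradmul (p * q) f = gradmul p f * q + p * gradmul q f.
Proof.
rewrite /gradmul mulr_suml mulr_sumr -big_split; apply: eq_bigr => i _ /=.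
by rewrite mderivM; ring.
Qed.

(** Replacing [normsq] by [1 - rho] in the term [4 a (a + 1) normsq p] isolates the only part not
    divisible by [rho]. This matters because [ibp] applies only behind a factor [rho]. *)
Lemma MpolyE a p : Mpoly a p =
  rho * (rho * lap p - cst (4 * (a + 1)) * euler p
         - cst (2 * (a + 1) * d%:R + 4 * a * (a + 1)) * p)
  + cst (4 * a * (a + 1)) * p.
Proof.
have E i : wderiv a i (wderiv (a + 1) i p) =
   rho * rho * mderiv i (mderiv i p)
   - cst (4 * (a + 1)) * (rho * (var i * mderiv i p))
   - cst (2 * (a + 1)) * (rho * p)
   + cst (4 * a * (a + 1)) * (var i * var i * p).
  rewrite /wderiv mderivB mderiv_mulC !mderivM mderivXU eqxx mderiv_rho mulr1n; ring.
rewrite /Mpoly; under eq_bigr do rewrite E.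
rewrite !(big_split, sumrN) /= -!mulr_sumr -mulr_suml -/normsq -/(lap p) -/(euler p).
by rewrite sumr_const card_ord -[normsq](subKr 1) -/rho; ring.
Qed.

(* The vanishing of the integral of the [i]-th derivative of [rho ^ (a + 1) * p]. *)
Definition ibp a (L : poly -> C) :=
  forall i p, L (rho * mderiv i p) = 2 * (a + 1) * L (var i * p).

Section Functional.
Context (a : C) (L : {scalar poly}) (a1 : a + 1 != 0) (Libp : ibp a L).

Lemma functional_cst c p : L (cst c * p) = c * L p.
Proof. by rewrite mul_mpolyC linearZ. Qed.

(** Up to the factor [2 (a + 1)], both sides are the integral of [rho] times the same mixed second
    derivative. In other words, rotation fields integrate to zero. *)
Lemma ibp_swap i j p : L (var j * mderiv i p) = L (var i * mderiv j p).
Proof.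
have b0 : 2 * (a + 1) != 0 by rewrite mulf_neq0 ?pnatr_eq0.
by apply: (mulfI b0); rewrite -!Libp mderiv_comm.
Qed.

Lemma ibp_euler p : L (rho * euler p) = 2 * (a + 1) * L (normsq * p) - d%:R * L (rho * p).
Proof.
rewrite /euler /normsq mulr_sumr mulr_suml !(linear_sum L) mulr_sumr /=.
have -> : d%:R * L (rho * p) = \sum_(i < d) L (rho * p).
  by rewrite sumr_const card_ord mulr_natl.
rewrite -sumrB; apply: eq_bigr => i _.
rewrite -[var i * var i * p]mulrA -Libp mderivM mderivXU eqxx mulr1n mul1r.
by rewrite mulrDr linearD /=; ring.
Qed.

Lemma ibp_euler_rho p :
  L (euler (rho * p)) = 2 * a * L p - (2 * a + d%:R) * L (rho * p).
Proof.
rewrite eulerM euler_rho linearD /= ibp_euler.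
have -> : - (normsq *+ 2) * p = rho * p *+ 2 - p *+ 2 by rewrite /rho; ring.
have -> : normsq * p = p - rho * p by rewrite /rho; ring.
by rewrite !(linearB, linearMn) /=; ring.
Qed.

Lemma ibp_green p q :
  L (rho * gradmul p q) = 2 * (a + 1) * L (p * euler q) - L (rho * p * lap q).
Proof.
rewrite /gradmul /euler /lap !mulr_sumr !(linear_sum L) mulr_sumr -sumrB.
apply: eq_bigr => i _ /=.
by rewrite (mulrCA p) -Libp mderivM !mulrDr linearD /= [rho * (p * _)]mulrA; ring.
Qed.

Lemma ibp_gradmul_rho p q :
  L (gradmul (rho * p) q) = 2 * a * L (p * euler q) - L (rho * p * lap q).
Proof.
rewrite gradmulMl linearD /= ibp_green.
have -> : gradmul rho q * p = - (p * euler q *+ 2) by rewrite gradmul_rho; ring.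
by rewrite linearN linearMn /=; ring.
Qed.

(** With no factor [rho] to absorb a boundary term, [1] is split as [rho + normsq]. The first part
    is integrated by parts; in the second, [ibp_swap] trades the derivatives of the components of
    [F] for the radial derivative of [x . F]. *)
Lemma ibp_div (F : 'I_d -> poly) : L (\sum_i mderiv i (F i)) =
  L (euler (\sum_i var i * F i)) + (d%:R + 2 * a) * L (\sum_i var i * F i).
Proof.
have splitL p : L p = L (rho * p) + L (normsq * p).
  by rewrite -linearD /= -mulrDl /rho subrK mul1r.
have rhoE : L (rho * \sum_i mderiv i (F i)) = 2 * (a + 1) * L (\sum_i var i * F i).
  by rewrite mulr_sumr !(linear_sum L) mulr_sumr; apply: eq_bigr => i _; exact: Libp.
have E1 : L (normsq * \sum_i mderiv i (F i)) + L (\sum_i var i * F i) =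
    \sum_i \sum_j L (var j * mderiv i (var j * F i)).
  rewrite mulr_sumr !(linear_sum L) -big_split; apply: eq_bigr => i _ /=.
  rewrite -(linear_sum L) -linearD /=; congr (L _).
  rewrite -[var i * F i](sum_deltar (fun j => var j * F i)) /normsq mulr_suml -big_split.
  by apply: eq_bigr => j _ /=; rewrite mderivM mderivXU; ring.
have E2 : L (euler (\sum_i var i * F i)) + (d%:R - 1) * L (\sum_i var i * F i) =
    \sum_i \sum_j L (var i * mderiv j (var j * F i)).
  rewrite /euler.
  under [in LHS]eq_bigr do rewrite mderiv_sum mulr_sumr.
  rewrite exchange_big mulrBl mul1r mulr_natl !(linear_sum L) /= -sumrMnl -sumrB -big_split.
  apply: eq_bigr => i _ /=.
  rewrite -!(linear_sum L) -linearMn -linearB -linearD /=.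
  have dE : var i * F i *+ d = \sum_(j < d) var i * F i by rewrite sumr_const card_ord.
  have iE := sum_deltar (fun j => var j * F i) i.
  rewrite dE -[X in _ - X]iE -sumrB -big_split; congr (L _).
  apply: eq_bigr => j _ /=.
  by rewrite !mderivM !mderivXU eqxx mulr1n eq_sym; ring.
have E3 : \sum_i \sum_j L (var j * mderiv i (var j * F i)) =
    \sum_i \sum_j L (var i * mderiv j (var j * F i)).
  by apply: eq_bigr => i _; apply: eq_bigr => j _; exact: ibp_swap.
rewrite splitL rhoE; apply: (addIr (L (\sum_i var i * F i))).
by rewrite -addrA E1 E3 -E2; ring.
Qed.

(* [Mpoly a u = rho * Kpoly u + 4 a (a + 1) u], and [Tpoly q] is
   [rho ^ (1 - a)] times the divergence of [rho ^ a * grad q]. *)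
Definition Kpoly u : poly := rho * lap u - cst (4 * (a + 1)) * euler u
  - cst (2 * (a + 1) * d%:R + 4 * a * (a + 1)) * u.

Definition Tpoly q : poly := rho * lap q - cst (2 * a) * euler q.

(** Green's formula used in both orders gives [sym]. The coefficients of [Kpoly] are such that all
    remaining terms combine into [L (euler p) + (d + 2 a) L p] with [p = u w]. *)
Lemma ibp_Kpoly u w : L (Kpoly u * w) = L (rho * u * lap w)
  - 2 * (a + 1) * (L (euler (u * w)) + (d%:R + 2 * a) * L (u * w)).
Proof.
have sym : L (rho * lap u * w) = 2 * (a + 1) * L (euler u * w)
    - 2 * (a + 1) * L (u * euler w) + L (rho * u * lap w).
  have gradmulC : gradmul w u = gradmul u w.
    by apply: eq_bigr => i _; rewrite mulrC.
  have := ibp_green u w; rewrite -gradmulC ibp_green.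
  have -> : rho * w * lap u = rho * lap u * w by ring.
  rewrite [w * _]mulrC => E.
  by rewrite -[LHS](subKr (2 * (a + 1) * L (euler u * w))) E; ring.
have -> : Kpoly u * w = rho * lap u * w - cst (4 * (a + 1)) * (euler u * w)
    - cst (2 * (a + 1) * d%:R + 4 * a * (a + 1)) * (u * w).
  by rewrite /Kpoly; ring.
by rewrite !linearB /= sym !functional_cst eulerM linearD /=; ring.
Qed.

(** For large [a] this is two integrations by parts, since [rho^(a - 1) Tpoly q] is the divergence
    of [rho^a grad q] and [rho^(a - 1) Mpoly a u] is the Laplacian of [rho^(a + 1) u]. Here the term
    [4 a (a + 1) u] is treated by [ibp_div] for the field [u grad q], and it cancels the extra term
    of [ibp_Kpoly]. *)
Lemma ibp_Mpoly u q :
  L (gradmul (Mpoly a u) q) = - L (rho * u * lap (Tpoly q)).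
Proof.
rewrite MpolyE -/(Kpoly u).
have gradD p f : gradmul (p + f) q = gradmul p q + gradmul f q.
  by rewrite -big_split; apply: eq_bigr => i _; rewrite mderivD mulrDl.
have gradZ c p : gradmul (cst c * p) q = cst c * gradmul p q.
  by rewrite mulr_sumr; apply: eq_bigr => i _; rewrite mderiv_mulC mulrA.
rewrite gradD gradZ linearD /= functional_cst ibp_gradmul_rho.
have -> : 2 * a * L (Kpoly u * euler q) - L (rho * Kpoly u * lap q) =
    - L (Kpoly u * Tpoly q).
  rewrite -functional_cst -linearB -linearN /=; congr (L _).
  by rewrite /Tpoly; ring.
rewrite ibp_Kpoly.
have TE : L (euler (u * Tpoly q)) + (d%:R + 2 * a) * L (u * Tpoly q) =
    2 * a * (L (u * lap q) - L (euler (u * euler q))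
             - (d%:R + 2 * a) * L (u * euler q)).
  have -> : u * Tpoly q = rho * (u * lap q) - cst (2 * a) * (u * euler q).
    by rewrite /Tpoly; ring.
  have eulerB p f : euler (p - f) = euler p - euler f.
    by rewrite -sumrB; apply: eq_bigr => i _; rewrite mderivB mulrBr.
  have eulerZ c p : euler (cst c * p) = cst c * euler p.
    by rewrite mulr_sumr; apply: eq_bigr => i _; rewrite mderiv_mulC mulrCA.
  rewrite eulerB eulerZ !linearB /= !functional_cst ibp_euler_rho; ring.
have divE := ibp_div (fun i => u * mderiv i q).
have uEq : \sum_i var i * (u * mderiv i q) = u * euler q.
  by rewrite mulr_sumr; apply: eq_bigr => i _; rewrite mulrCA.
have divuE : \sum_i mderiv i (u * mderiv i q) = gradmul u q + u * lap q.
  by rewrite mulr_sumr -big_split; apply: eq_bigr => i _; rewrite mderivM.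
move: divE; rewrite uEq divuE linearD /= => /eqP; rewrite -subr_eq => /eqP divE.
rewrite TE; move: divE.
move: (L (gradmul u q)) (L (u * lap q)) => x y divE.
have -> : x = L (euler (u * euler q)) + (d%:R + 2 * a) * L (u * euler q) - y.
  by rewrite -divE; ring.
by ring.
Qed.

(** [L (Mpoly a u)] is the integral of [rho] times the Laplacian of [rho^(a + 1) u]; moving the
    Laplacian onto [rho] gives the factor [- 2 d]. *)
Lemma functional_Mpoly u : L (Mpoly a u) = - (2 * d%:R) * L (rho * u).
Proof.
have wderivE i p : L (wderiv a i p) = 2 * L (var i * p).
  by rewrite /wderiv linearB /= functional_cst Libp; ring.
rewrite /Mpoly (linear_sum L) /=.
have -> : - (2 * d%:R) * L (rho * u) = \sum_(i < d) - (2 * L (rho * u)).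
  by rewrite sumr_const card_ord -mulr_natr; ring.
apply: eq_bigr => i _; rewrite wderivE.
have -> : var i * wderiv (a + 1) i u =
    rho * mderiv i (var i * u) - rho * u - cst (2 * (a + 1)) * (var i * (var i * u)).
  by rewrite /wderiv mderivM mderivXU eqxx mulr1n; ring.
by rewrite !linearB /= functional_cst Libp; ring.
Qed.

End Functional.

(** If [L] integrates against [rho^a], this integrates against [rho^(a + 1)], the weight for which
    the arguments of [M] are orthogonal. *)
Definition rho_mul (L : poly -> C) p : C := L (rho * p).

Fact rho_mul_is_linear (L : {scalar poly}) : scalar (rho_mul L).
Proof. by move=> c p q; rewrite /rho_mul mulrDr -scalerAr linearP. Qed.

HB.instance Definition _ (L : {scalar poly}) :=
  GRing.isLinear.Build C poly C *%R (rho_mul L) (rho_mul_is_linear L).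

Lemma ibp_rho_mul a (L : {scalar poly}) : ibp a L -> ibp (a + 1) (rho_mul L).
Proof.
move=> Libp i p; rewrite /rho_mul.
have -> : rho * (rho * mderiv i p) =
    rho * mderiv i (rho * p) + rho * (var i * p) *+ 2.
  by rewrite mderivM mderiv_rho; ring.
have -> : rho * (var i * p) = var i * (rho * p) by ring.
by rewrite linearD linearMn /= Libp; ring.
Qed.

(** * Degrees, Euler's identity and harmonic polynomials *)

Lemma msize_leP k p :
  reflect (forall m, m \in msupp p -> (mdeg m < k)%N) (msize p <= k)%N.
Proof.
apply: (iffP idP) => [pk m mp|H]; first exact: leq_trans (msize_mdeg_lt mp) pk.
by rewrite msizeE; apply/bigmax_leqP_seq => m mp _; exact: H.
Qed.

Lemma msize_add_le k p q : (msize p <= k)%N -> (msize q <= k)%N -> (msize (p + q) <= k)%N.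
Proof. by move=> pk qk; rewrite (leq_trans (msizeD_le _ _)) // geq_max pk. Qed.

Lemma msize_sub_le k p q : (msize p <= k)%N -> (msize q <= k)%N -> (msize (p - q) <= k)%N.
Proof. by move=> pk qk; apply: msize_add_le => //; rewrite msizeN. Qed.

Lemma msize_bigsum k (F : 'I_d -> poly) :
  (forall i, (msize (F i) <= k)%N) -> (msize (\sum_i F i) <= k)%N.
Proof.
by move=> H; elim/big_ind: _ => [|? ? ? ?|i _] //; [rewrite msize0|exact: msize_add_le].
Qed.

Lemma msize_mul_le k l p q : (msize p <= k.+1)%N -> (msize q <= l)%N ->
  (msize (p * q) <= k + l)%N.
Proof.
move=> /msize_leP pk /msize_leP ql; apply/msize_leP => m /msuppM_le /allpairsP.
move=> [[m1 m2] [/= /pk k1 /ql l2 ->]]; rewrite mdegD -addnS.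
by apply: leq_add.
Qed.

Lemma msize_cstM k c p : (msize p <= k)%N -> (msize (cst c * p) <= k)%N.
Proof. by move=> pk; rewrite mul_mpolyC (leq_trans (msizeZ_le _ _)). Qed.

Lemma msize_var i : msize (var i) = 2%N.
Proof. by rewrite msizeX mdeg1. Qed.

Lemma msize_normsq : (msize normsq <= 3)%N.
Proof. by apply: msize_bigsum => i; apply: (@msize_mul_le 1 2); rewrite msize_var. Qed.

Lemma msize_rho : (msize rho <= 3)%N.
Proof. by apply: msize_sub_le; rewrite ?msize1 // msize_normsq. Qed.

Lemma msize_mderiv k i p : (msize p <= k)%N -> (msize (mderiv i p) <= k.-1)%N.
Proof.
move=> /msize_leP pk; apply/msize_leP => m; rewrite mcoeff_msupp mcoeff_mderiv => H.
have : mnm_add m (mnm1 i) \in msupp p.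
  by rewrite mcoeff_msupp; apply: contraNneq H => ->; rewrite mul0rn.
by move/pk; rewrite mdegD mdeg1 addn1; case: k {pk}.
Qed.

Lemma dhomog_mderiv k i p : p \is ishomog1 k mdeg ->
  mderiv i p \is ishomog1 k.-1 mdeg.
Proof.
move=> /dhomogP pk; apply/dhomogP => m; rewrite mcoeff_msupp mcoeff_mderiv => H.
have : mnm_add m (mnm1 i) \in msupp p.
  by rewrite mcoeff_msupp; apply: contraNneq H => ->; rewrite mul0rn.
by move/pk; rewrite /= mdegD mdeg1 addn1 => <-.
Qed.

Lemma dhomog_lap k p : p \is ishomog1 k mdeg -> lap p \is ishomog1 k.-2 mdeg.
Proof. by move=> pk; apply: rpred_sum => i _; do 2 apply: dhomog_mderiv. Qed.

Lemma dhomog_normsqM k p : p \is ishomog1 k mdeg ->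
  normsq * p \is ishomog1 k.+2 mdeg.
Proof.
move=> pk; rewrite -add2n; apply: dhomogM pk.
by apply: rpred_sum => i _; apply: (@dhomogM _ _ _ 1 _ 1); rewrite dhomogX /= mdeg1.
Qed.

Lemma dhomog_msize_le k p : p \is ishomog1 k mdeg -> (msize p <= k.+1)%N.
Proof. by move=> /dhomogP pk; apply/msize_leP => m /pk /= ->. Qed.

Lemma lap_low k p : (k <= 1)%N -> p \is ishomog1 k mdeg -> lap p = 0.
Proof.
move=> k1 /dhomog_msize_le pk; apply: big1 => i _; apply/eqP.
have /(msize_mderiv i)/(msize_mderiv i)/= := leq_trans pk (k1 : (k < 2)%N).
by rewrite leqn0 msize_poly_eq0.
Qed.

Lemma euler_homog k p : p \is ishomog1 k mdeg -> euler p = cst k%:R * p.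
Proof.
have eulerX m : euler (mpolyX C m) = cst (mdeg m)%:R * mpolyX C m.
  have E i : var i * mderiv i (mpolyX C m) = (m i)%:R *: mpolyX C m.
    rewrite mderivX -scalerAr; have [->|mi0] := eqVneq (m i) 0%N.
      by rewrite !scale0r.
    by rewrite -mpolyXD addmC submK // lep1mP.
  rewrite /euler; under eq_bigr do rewrite E.
  by rewrite -scaler_suml mul_mpolyC mdegE natr_sum.
move=> /dhomogP pk.
have eulerZ c q : euler (c *: q) = c *: euler q.
  by rewrite scaler_sumr; apply: eq_bigr => i _; rewrite mderivZ scalerAr.
have eulerD q r : euler (q + r) = euler q + euler r.
  by rewrite -big_split; apply: eq_bigr => i _; rewrite mderivD mulrDr.
have euler0 : euler 0 = 0.
  by rewrite /euler big1 // => i _; rewrite mderiv0 mulr0.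
rewrite {1}(mpolyE p) (big_morph _ eulerD euler0) {3}(mpolyE p) mulr_sumr.
rewrite big_seq [RHS]big_seq; apply: eq_bigr => m mp.
by rewrite eulerZ eulerX -scalerAr (pk _ mp).
Qed.

Lemma lap_normsqM k g : g \is ishomog1 k mdeg ->
  lap (normsq * g) = normsq * lap g + cst (4 * k%:R + 2 * d%:R) * g.
Proof.
move=> gk; rewrite lapM.
have -> : lap normsq = cst (2 * d%:R).
  rewrite /lap; under eq_bigr do rewrite mderiv_normsq mderivMn mderivXU eqxx mulr1n.
  by rewrite sumr_const card_ord -mulrnA mulr_natr; ring.
have -> : gradmul normsq g = euler g *+ 2.
  by rewrite -sumrMnl; apply: eq_bigr => i _; rewrite mderiv_normsq mulrnAl.
by rewrite (euler_homog gk); ring.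
Qed.

(* [lap] intertwines the operator with parameter [c] in degree [k + 2] and the
   one with parameter [c + 4k + 2d] in degree [k], which gives an explicit
   inverse by induction on the degree. *)
Lemma normsq_lap_surj k c g : 0 < c -> g \is ishomog1 k mdeg ->
  exists2 f, f \is ishomog1 k mdeg & normsq * lap f + cst c * f = g.
Proof.
elim/ltn_ind: k c g => k IH c g c0 gk.
have low : lap g = 0 -> exists2 f, f \is ishomog1 k mdeg & normsq * lap f + cst c * f = g.
  move=> lg; exists (c^-1 *: g); first exact: rpredZ.
  have -> : lap (c^-1 *: g) = c^-1 *: lap g.
    by rewrite scaler_sumr; apply: eq_bigr => i _; rewrite !mderivZ.
  by rewrite lg scaler0 mulr0 add0r mul_mpolyC scalerA mulfV ?scale1r // gt_eqF.
case: k => [|[|k]] in IH gk low *.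
- exact/low/(lap_low _ gk).
- exact/low/(lap_low _ gk).
have [//|||f fk fE] := IH k _ (c + (4 * k%:R + 2 * d%:R)) (lap g).
- by rewrite ltr_wpDr // addr_ge0 // mulr_ge0 // ler0n.
- exact: dhomog_lap gk.
(* By the choice of [f], the Laplacian of [g - normsq * f] collapses to [c f], so the first term of
   the operator restores exactly the subtracted [normsq * f]. *)
exists (c^-1 *: (g - normsq * f)).
  by apply: rpredZ; apply: rpredB => //; exact: dhomog_normsqM.
have lapZB p q : lap (c^-1 *: (p - q)) = c^-1 *: (lap p - lap q).
  rewrite -sumrB scaler_sumr; apply: eq_bigr => i _.
  by rewrite !mderivZ !mderivB.
have cK x : cst c * (c^-1 *: x) = x.
  by rewrite mul_mpolyC scalerA mulfV ?scale1r ?gt_eqF.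
rewrite lapZB (lap_normsqM fk) -fE cK.
have -> : normsq * lap f + cst (c + (4 * k%:R + 2 * d%:R)) * f -
    (normsq * lap f + cst (4 * k%:R + 2 * d%:R) * f) = c *: f.
  by rewrite -mul_mpolyC; ring.
by rewrite scalerA mulVf ?gt_eqF // scale1r addrC subrK.
Qed.

(** One needs [g] with [lap (normsq * g) = lap p]. By [lap_normsqM] this is the equation of
    [normsq_lap_surj] with parameter [4 k + 2 d], positive even for [k = 0] because [0 < d]. *)
Lemma fischer k p : (0 < d)%N -> p \is ishomog1 k.+2 mdeg ->
  exists h g, [/\ h \is ishomog1 k.+2 mdeg, lap h = 0,
    g \is ishomog1 k mdeg & p = h + normsq * g].
Proof.
move=> d0 pk.
have c0 : 0 < 4 * k%:R + 2 * d%:R :> C.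
  by rewrite ltr_wpDl ?mulr_ge0 ?ler0n // mulr_gt0 // ltr0n.
have [g gk gE] := normsq_lap_surj c0 (dhomog_lap pk).
exists (p - normsq * g), g; split => //; last by rewrite subrK.
  by apply: rpredB => //; exact: dhomog_normsqM.
have -> : lap (p - normsq * g) = lap p - lap (normsq * g).
  by rewrite -sumrB; apply: eq_bigr => i _; rewrite !mderivB.
by rewrite (lap_normsqM gk) -gE subrr.
Qed.

(** Green's formula with [lap h = 0] and Euler's identity turn [L (q h)] into a multiple of
    [L (rho (grad q . grad h))]. The derivatives of [h] are harmonic of degree one less, so
    induction applies with [rho_mul L] and [a + 1]; this is why [a] and [L] are generalized. *)
Lemma harmonic_orth a (L : {scalar poly}) k h q : 0 < a + 1 -> ibp a L ->
  h \is ishomog1 k mdeg -> lap h = 0 -> (msize q <= k)%N -> L (q * h) = 0.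
Proof.
elim: k a L h q => [|k IH] a L h q a1 Libp hk lh qk.
  by move: qk; rewrite leqn0 msize_poly_eq0 => /eqP ->; rewrite mul0r linear0.
have := ibp_green Libp q h.
rewrite lh mulr0 linear0 subr0 (euler_homog hk) mulrCA functional_cst.
have -> : L (rho * gradmul q h) = 0.
  rewrite mulr_sumr (linear_sum L) big1 //= => i _.
  apply: (IH (a + 1) (rho_mul L)).
  - by rewrite ltr_wpDr.
  - exact: ibp_rho_mul.
  - exact: dhomog_mderiv hk.
  - rewrite -[RHS](mderiv0 _ i) -lh mderiv_sum; apply: eq_bigr => j _.
    by rewrite !(mderiv_comm i).
  - exact: msize_mderiv qk.
by move/esym/eqP; rewrite !mulf_eq0 !pnatr_eq0 (gt_eqF a1) /= => /eqP.
Qed.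

Lemma msize_wderiv k s i p : (msize p <= k)%N -> (msize (wderiv s i p) <= k.+1)%N.
Proof.
case: k => [|k] pk.
  move: pk; rewrite leqn0 msize_poly_eq0 => /eqP ->.
  by rewrite /wderiv mderiv0 !mulr0 subr0 msize0.
apply: msize_sub_le; first exact: msize_mul_le msize_rho (msize_mderiv i pk).
by apply: msize_cstM; apply: (@msize_mul_le 1) => //; rewrite msize_var.
Qed.

Lemma msize_Mpoly k a p : (msize p <= k)%N -> (msize (Mpoly a p) <= k.+2)%N.
Proof. by move=> pk; apply: msize_bigsum => i; do 2 apply: msize_wderiv. Qed.

(** In top degree [rho] acts as [- normsq] and [euler] as multiplication by [k]; the constant is
    [4 (a + 1) k + 2 (a + 1) d + 4 a (a + 1)], factored. *)
Lemma Mpoly_top k a g : g \is ishomog1 k mdeg ->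
  (msize (Mpoly a g - normsq * (normsq * lap g
     + cst (2 * (a + 1) * (2 * k%:R + d%:R + 2 * a)) * g)) <= k.+2)%N.
Proof.
move=> gk; rewrite MpolyE (euler_homog gk).
have -> : rho * (rho * lap g - cst (4 * (a + 1)) * (cst k%:R * g)
     - cst (2 * (a + 1) * d%:R + 4 * a * (a + 1)) * g)
    + cst (4 * a * (a + 1)) * g - normsq * (normsq * lap g
     + cst (2 * (a + 1) * (2 * k%:R + d%:R + 2 * a)) * g) =
   lap g - cst 2 * (normsq * lap g)
   - cst (4 * (a + 1) * k%:R + 2 * (a + 1) * d%:R) * g.
  by rewrite /rho; ring.
have gs := dhomog_msize_le gk.
have lg : (msize (lap g) <= k.-1)%N.
  by apply: msize_bigsum => i; apply: msize_mderiv; exact: msize_mderiv gs.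
apply: msize_sub_le; last by apply: msize_cstM; exact: leq_trans gs _.
apply: msize_sub_le; first by rewrite (leq_trans lg) //; case: (k) => // n; rewrite /= ltnW // ltnW.
apply: msize_cstM; rewrite (leq_trans (msize_mul_le msize_normsq lg)) // add2n.
by case: (k).
Qed.

Lemma pihomog_msize k p : (msize p <= k.+1)%N -> (msize (p - pihomog mdeg k p) <= k)%N.
Proof.
move=> pk; rewrite {1}(pihomog_partitionE pk) big_ord_recr /= addrK.
elim/big_ind: _ => [|? ? ? ?|i _]; [by rewrite msize0|exact: msize_add_le|].
exact: leq_trans (dhomog_msize_le (pihomogP _ _ _)) _.
Qed.

Lemma mderiv_eq0 p : (forall i, mderiv i p = 0) -> p = cst (mcoeff (@mnm0 d) p).
Proof.
move=> dp0; apply: msize1_polyC; apply/msize_leP => m mp; rewrite ltnS leqn0.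
rewrite mdeg_eq0; apply/eqP/mnmP => i; rewrite mnm0E; apply/eqP; apply: contraTT mp.
move=> mi0; have := congr1 (mcoeff (mnm_sub m (mnm1 i))) (dp0 i).
rewrite mcoeff0 mcoeff_mderiv submK ?lep1mP // => /eqP.
by rewrite mulrn_eq0 /= => /eqP pm0; rewrite mcoeff_msupp pm0 eqxx.
Qed.

End BallAlgebra.

(** * Sobolev orthogonal polynomials *)

Section Sobolev.
Context {C : numClosedFieldType} {d : nat}.
Local Notation poly := (mpoly.mpoly d C).
Local Notation cst := (@mpoly.mpolyC d C).
Local Notation var i := (@mpoly.mpolyX d C (mpoly.mnm1 i)).
Implicit Types (p q h u v w : poly) (i j : 'I_d) (a c : C).

Definition cj : poly -> poly := map_mpoly (@Num.conj C).

Lemma cjD p q : cj (p + q) = cj p + cj q. Proof. exact: rmorphD. Qed.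
Lemma cjB p q : cj (p - q) = cj p - cj q. Proof. exact: rmorphB. Qed.
Lemma cjM p q : cj (p * q) = cj p * cj q. Proof. exact: rmorphM. Qed.
Lemma cjC c : cj (cst c) = cst (c^*). Proof. exact: map_mpolyC. Qed.
Lemma cjX i : cj (var i) = var i. Proof. exact: map_mpolyX. Qed.
Lemma cj_sum (F : 'I_d -> poly) : cj (\sum_i F i) = \sum_i cj (F i).
Proof. exact: rmorph_sum. Qed.

Lemma cjK p : cj (cj p) = p.
Proof. by apply/mpolyP => m; rewrite !mcoeff_map_mpoly /= conjCK. Qed.

Lemma mderiv_cj i p : mderiv i (cj p) = cj (mderiv i p).
Proof.
apply/mpolyP => m.
by rewrite mcoeff_mderiv !mcoeff_map_mpoly mcoeff_mderiv /= rmorphMn.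
Qed.

Lemma msize_cj k p : (msize p <= k)%N -> (msize (cj p) <= k)%N.
Proof.
move=> /msize_leP pk; apply/msize_leP => m.
rewrite mcoeff_msupp mcoeff_map_mpoly /= => cp; apply: pk.
by rewrite mcoeff_msupp; apply: contraNneq cp => ->; rewrite rmorph0.
Qed.

Lemma cj_normsq : cj normsq = normsq.
Proof. by rewrite cj_sum; apply: eq_bigr => i _; rewrite cjM !cjX. Qed.

Lemma cj_rho : cj rho = rho.
Proof. by rewrite cjB cj_normsq /cj rmorph1. Qed.

Lemma lap_cj p : lap (cj p) = cj (lap p).
Proof. by rewrite cj_sum; apply: eq_bigr => i _; rewrite !mderiv_cj. Qed.

Lemma MpolyB a u v : Mpoly a (u - v) = Mpoly a u - Mpoly a v.
Proof.
have wB s i p q : wderiv s i (p - q) = wderiv s i p - wderiv s i q.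
  by rewrite /wderiv mderivB; ring.
by rewrite -sumrB; apply: eq_bigr => i _; rewrite !wB.
Qed.

Definition ip (L : poly -> C) p q : C := L (p * cj q).

Definition ip1 (L : poly -> C) p q : C :=
  \sum_i ip L (mderiv i p) (mderiv i q) + (ip L 1 1)^-1 * ip L p 1 * (ip L q 1)^*.

(** [msize] exceeds the degree by one, so [q] ranges over the degrees below [n], and only over [0]
    when [n = 0]. *)
Definition orthpoly (B : poly -> poly -> C) n p :=
  (msize p <= n.+1)%N /\ forall q, (msize q <= n)%N -> B p q = 0.

Section Form.
Context (L : {scalar poly}).
Hypothesis (Lcj : forall p, L (cj p) = (L p)^*)
  (Lge0 : forall p, 0 <= L (p * cj p)) (Lpos : forall p, L (p * cj p) = 0 -> p = 0).

Lemma ip_linearl c p q r : ip L (c *: p + q) r = c * ip L p r + ip L q r.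
Proof. by rewrite /ip mulrDl -scalerAl linearP. Qed.

Lemma ipC p q : ip L q p = (ip L p q)^*.
Proof. by rewrite /ip -Lcj cjM cjK mulrC. Qed.

Lemma ip1C p q : ip1 L q p = (ip1 L p q)^*.
Proof.
rewrite /ip1 rmorphD rmorph_sum !rmorphM /= fmorphV /= conjCK -(ipC 1 1).
rewrite [RHS]addrC mulrAC addrC; congr (_ + _).
by apply: eq_bigr => i _; rewrite ipC.
Qed.

Lemma ip1_linearl c p q r : ip1 L (c *: p + q) r = c * ip1 L p r + ip1 L q r.
Proof.
rewrite /ip1 !ip_linearl.
under eq_bigr do rewrite mderivD mderivZ ip_linearl.
by rewrite big_split /= -mulr_sumr; ring.
Qed.

Lemma ip1Bl p q r : ip1 L (p - q) r = ip1 L p r - ip1 L q r.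
Proof. by rewrite addrC -scaleN1r ip1_linearl; ring. Qed.

Lemma ip1Br p q r : ip1 L r (p - q) = ip1 L r p - ip1 L r q.
Proof. by rewrite ip1C ip1Bl rmorphB /= -!ip1C. Qed.

Lemma ip11_neq0 : ip L 1 1 != 0.
Proof. by apply/eqP => /Lpos/eqP; rewrite oner_eq0. Qed.

(** Both terms of the form are nonnegative. The vanishing gradient term leaves a constant, and the
    mean-value term kills it. *)
Lemma ip1_eq0 p : ip1 L p p = 0 -> p = 0.
Proof.
have c0 : 0 < ip L 1 1 by rewrite lt_neqAle eq_sym ip11_neq0 Lge0.
have s0 : 0 <= \sum_i ip L (mderiv i p) (mderiv i p).
  by apply: sumr_ge0 => i _; exact: Lge0.
have t0 : 0 <= (ip L 1 1)^-1 * (ip L p 1 * (ip L p 1)^*).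
  by rewrite mulr_ge0 ?mul_conjC_ge0 // invr_ge0 ltW.
rewrite /ip1 -mulrA => /eqP; rewrite paddr_eq0 // => /andP[/eqP sE].
rewrite mulf_eq0 invr_eq0 (gt_eqF c0) /= mul_conjC_eq0 => /eqP pE.
have dp0 i : mderiv i p = 0.
  have /psumr_eq0P : forall i, true -> 0 <= ip L (mderiv i p) (mderiv i p).
    by move=> j _; exact: Lge0.
  by move/(_ sE i isT)/Lpos.
move: pE; rewrite (mderiv_eq0 dp0) /ip functional_cst -[cj 1]mul1r -/(ip L 1 1) => /eqP.
by rewrite mulf_eq0 (gt_eqF c0) orbF => /eqP ->; rewrite mpolyC0.
Qed.

(* Spans are represented by the linear predicates containing the generators. *)
Lemma gram_schmidt (s : seq poly) v : exists2 w,
  (forall P : poly -> Prop, P 0 -> (forall c p q, P p -> P q -> P (c *: p + q)) ->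
     (forall x, x \in s -> P x) -> P w) &
  forall x, x \in s -> ip L (v - w) x = 0.
Proof.
have ipBl p q r : ip L (p - q) r = ip L p r - ip L q r.
  by rewrite addrC -scaleN1r ip_linearl; ring.
have ipZl c p r : ip L (c *: p) r = c * ip L p r.
  by rewrite -[c *: p]addr0 ip_linearl /ip mul0r linear0 addr0.
elim: s v => [|x s IH] v; first by exists 0.
have [w0 w0s w0o] := IH v; have [y ys yo] := IH x.
pose e := x - y.
pose c := ip L (v - w0) e / ip L e e.
exists (c *: e + w0) => [P P0 PL Ps|z].
  have PLs z : z \in s -> P z by move=> zs; apply: Ps; rewrite inE zs orbT.
  apply: (PL); last exact: (w0s P P0 PL PLs).
  rewrite /e addrC -scaleN1r; apply: (PL); first exact: (ys P P0 PL PLs).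
  by apply: Ps; rewrite inE eqxx.
have os t : t \in s -> ip L (v - (c *: e + w0)) t = 0.
  by move=> ts; rewrite ipBl ip_linearl opprD addrCA -ipBl w0o // yo // mulr0 oppr0 add0r.
rewrite inE => /predU1P[->|]; last exact: os.
(* [y] lies in the span of [s], hence inherits the orthogonality to [s]. *)
have oy : ip L (v - (c *: e + w0)) y = 0.
  rewrite ipC; apply/eqP; rewrite conjC_eq0; apply/eqP.
  apply: (ys (fun y => ip L y _ = 0)) => [|b p q p0 q0|t ts].
  - by rewrite /ip mul0r linear0.
  - by rewrite ip_linearl p0 q0 mulr0 addr0.
  - by rewrite ipC os // rmorph0.
rewrite -[x](subrK y) -/e /ip cjD mulrDr linearD /= -!/(ip L _ _) oy addr0.
(* If [x] already lies in the span of [s], then [e = 0] and the quotient [c] has denominator zero,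
   but it only multiplies [e]. *)
have [e0|e0] := eqVneq (ip L e e) 0; first by rewrite (Lpos e0) /ip /cj rmorph0 mulr0 linear0.
by rewrite ipBl ip_linearl opprD addrCA -ipBl /c mulfVK // addNr.
Qed.

Lemma orth_projection n v : exists2 w, (msize w <= n)%N &
  forall q, (msize q <= n)%N -> ip L (v - w) q = 0.
Proof.
pose s := [seq mpolyX C (m : multinom d) | m : bmultinom d n].
have [w ws wo] := gram_schmidt s v; exists w => [|q qn].
  apply: (ws (fun w => msize w <= n)%N) => [|c p q pn qn|x].
  - by rewrite msize0.
  - by apply: msize_add_le => //; rewrite -mul_mpolyC msize_cstM.
  - by case/mapP => m _ ->; rewrite msizeX bmdeg.
rewrite (mpolyE q) /ip /cj rmorph_sum mulr_sumr (linear_sum L) big_seq big1 //= => m mq.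
rewrite map_mpolyZ -scalerAr linearZ /= -/(ip L (v - w) (mpolyX C m)) wo ?mulr0 //.
have mn : (mdeg m < n)%N by move/msize_leP: qn; exact.
by apply/mapP; exists (BMultinom mn); rewrite ?mem_enum.
Qed.

End Form.

Section Decomposition.
Context (a : C) (L : {scalar poly}).
Hypothesis (a1 : 0 < a + 1) (Libp : ibp a L) (Lcj : forall p, L (cj p) = (L p)^*)
  (Lge0 : forall p, 0 <= L (p * cj p)) (Lpos : forall p, L (p * cj p) = 0 -> p = 0)
  (Spos : forall p, L (rho * (p * cj p)) = 0 -> p = 0).

Local Notation V1 := (orthpoly (ip1 L)).

Let aC : a^* = a.
Proof.
by have := gtr0_real a1; rewrite rpredDr ?rpred1 // => /CrealP.
Qed.

Let Scj p : rho_mul L (cj p) = (rho_mul L p)^*.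
Proof. by rewrite /rho_mul -Lcj cjM cj_rho. Qed.

Let Lvar i : L (var i) = 0.
Proof.
have := Libp i 1; rewrite mderiv1 mulr0 linear0 mulr1 => /esym/eqP.
by rewrite !mulf_eq0 pnatr_eq0 (gt_eqF a1) => /eqP.
Qed.

Lemma V1_harmonic n h : (0 < n)%N -> h \is ishomog1 n mdeg -> lap h = 0 -> V1 n h.
Proof.
move=> n0 hn lh; split=> [|q qn]; first exact: dhomog_msize_le.
have hL1 : ip L h 1 = 0.
  rewrite /ip mulrC; apply: (harmonic_orth a1 Libp hn lh).
  by apply: msize_cj; rewrite msize1.
rewrite /ip1 hL1 mulr0 mul0r addr0; apply: big1 => i _; rewrite /ip mulrC.
apply: (harmonic_orth a1 Libp (dhomog_mderiv i hn)).
  rewrite -[RHS](mderiv0 _ i) -lh mderiv_sum; apply: eq_bigr => j _.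
  by rewrite !(mderiv_comm i).
exact/msize_cj/msize_mderiv.
Qed.

(** Only the gradient term survives: the mean of [Mpoly a u] is a multiple of [L (rho u)], which
    vanishes because [0 < k] makes [1] a test polynomial for [u]. Conjugation commutes with
    [Tpoly a] since [a] is real. *)
Lemma ip1_Mpoly k u q : (0 < k)%N -> orthpoly (ip (rho_mul L)) k u ->
  ip1 L (Mpoly a u) q = - ip (rho_mul L) u (lap (Tpoly a q)).
Proof.
move=> k0 [_ uo]; rewrite /ip1.
have cj1 : cj 1 = 1 by rewrite /cj rmorph1.
have -> : ip L (Mpoly a u) 1 = 0.
  rewrite /ip cj1 mulr1 (functional_Mpoly Libp).
  have := uo 1; rewrite /ip cj1 mulr1 /rho_mul => -> //; first by rewrite mulr0.
  by rewrite msize1.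
rewrite mulr0 mul0r addr0.
under eq_bigr do rewrite /ip -mderiv_cj.
rewrite -linear_sum /= -/(gradmul _ _) ibp_Mpoly ?gt_eqF //.
congr (- _); rewrite /ip /rho_mul mulrA -lap_cj; congr (L (_ * lap _)).
have a2C : (2 * a)^* = 2 * a by rewrite rmorphM /= aC rmorph_nat.
rewrite /Tpoly cjB !cjM cj_rho lap_cj cjC a2C; congr (_ - _ * _).
by rewrite cj_sum; apply: eq_bigr => i _; rewrite cjM cjX mderiv_cj.
Qed.

(** [Tpoly a] does not raise the degree, so for [q] of degree at most [k + 1] the Laplacian of
    [Tpoly a q] has degree below [k], where [u] is orthogonal. *)
Lemma V1_Mpoly k u : (0 < k)%N -> orthpoly (ip (rho_mul L)) k u -> V1 k.+2 (Mpoly a u).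
Proof.
move=> k0 uV; split=> [|q qk]; first by apply: msize_Mpoly; case: uV.
rewrite (ip1_Mpoly _ k0 uV) (_ : ip _ _ _ = 0) ?oppr0 //; case: uV => _; apply.
have dq i : (msize (mderiv i q) <= k.+1)%N by exact: msize_mderiv qk.
have ddq i : (msize (mderiv i (mderiv i q)) <= k)%N by exact: msize_mderiv (dq i).
suff Tk : (msize (Tpoly a q) <= k.+2)%N.
  by apply: msize_bigsum => i; exact: (msize_mderiv i (msize_mderiv i Tk)).
apply: msize_sub_le; first by apply: (msize_mul_le msize_rho); exact: msize_bigsum.
apply: msize_cstM; apply: msize_bigsum => i.
by apply: (@msize_mul_le _ _ 1) => //; rewrite msize_var.
Qed.

Lemma ip1_harmonic_Mpoly k n h u : (0 < k)%N -> orthpoly (ip (rho_mul L)) k u ->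
  h \is ishomog1 n mdeg -> lap h = 0 -> ip1 L h (Mpoly a u) = 0.
Proof.
move=> k0 uV hn lh; rewrite ip1C // (ip1_Mpoly _ k0 uV).
(* On a harmonic homogeneous polynomial [Tpoly a] is multiplication by [- 2 a n], so the result is
   harmonic again. *)
rewrite /Tpoly lh mulr0 sub0r (euler_homog hn) mulrA -mpolyCM.
have -> : lap (- (cst (2 * a * n%:R) * h)) = - (cst (2 * a * n%:R) * lap h).
  rewrite mulr_sumr -sumrN; apply: eq_bigr => i _.
  by rewrite !mderivN !mderiv_mulC.
by rewrite lh mulr0 oppr0 /ip /cj rmorph0 mulr0 linear0 oppr0 rmorph0.
Qed.

Lemma V1B n p q : V1 n p -> V1 n q -> V1 n (p - q).
Proof.
move=> [pn po] [qn qo]; split=> [|r rn]; first exact: msize_sub_le.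
by rewrite ip1Bl // po // qo // subrr.
Qed.

Lemma V1_decomposition k p : (0 < d)%N -> (0 < k)%N -> V1 k.+2 p ->
  exists h u, [/\ h \is ishomog1 k.+2 mdeg, lap h = 0,
    orthpoly (ip (rho_mul L)) k u & p = h + Mpoly a u].
Proof.
move=> d0 k0 pV; have [pk po] := pV.
have [h [g [hk lh gk pE]]] := fischer d0 (pihomogP mdeg k.+2 p).
(* Positivity rests on [1 <= k]: for [k = 0] the last factor is [d + 2 a], which can vanish or be
   negative. *)
have c0 : 0 < 2 * (a + 1) * (2 * k%:R + d%:R + 2 * a).
  rewrite mulr_gt0 ?mulr_gt0 //.
  have -> : 2 * k%:R + d%:R + 2 * a = 2 * (a + 1) + 2 * (k%:R - 1) + d%:R by ring.
  rewrite ltr_wpDl ?ltr0n // addr_ge0 // mulr_ge0 ?(ltW a1) //.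
  by rewrite subr_ge0 ler1n.
have [f fk fE] := normsq_lap_surj c0 gk.
(* [f] yields the right top part but need not be orthogonal. Subtracting its projection [w], of
   degree below [k], changes [Mpoly a f] only in degrees below [k + 2]. *)
have [w wk wo] := orth_projection Scj Spos k f.
have uV : orthpoly (ip (rho_mul L)) k (f - w).
  by split=> //; apply: msize_sub_le; [exact: dhomog_msize_le|exact: leq_trans wk _].
exists h, (f - w); split=> //.
have rV : V1 k.+2 (p - h - Mpoly a (f - w)).
  by apply: V1B; [apply: V1B => //; exact: V1_harmonic|exact: V1_Mpoly].
(* The remainder belongs to [V1 k.+2], and its degree is below [k + 2], so it is one of its own test
   polynomials. *)
suff /(ip1_eq0 Lge0 Lpos) : ip1 L (p - h - Mpoly a (f - w)) (p - h - Mpoly a (f - w)) = 0.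
  by move/eqP; rewrite subr_eq0 subr_eq addrC => /eqP.
case: rV => _; apply.
have -> : p - h - Mpoly a (f - w) = p - pihomog mdeg k.+2 p
    - (Mpoly a f - normsq * g) + Mpoly a w.
  by rewrite MpolyB pE; ring.
apply: msize_add_le; last exact: msize_Mpoly.
apply: msize_sub_le; first exact: pihomog_msize.
by rewrite -fE; exact: Mpoly_top.
Qed.

(** [h - h'] equals a difference of values of [Mpoly a], to which it is orthogonal, so it is
    orthogonal to itself. *)
Lemma decomposition_uniq k h h' u u' : (0 < k)%N ->
  h \is ishomog1 k.+2 mdeg -> lap h = 0 -> h' \is ishomog1 k.+2 mdeg -> lap h' = 0 ->
  orthpoly (ip (rho_mul L)) k u -> orthpoly (ip (rho_mul L)) k u' ->
  h + Mpoly a u = h' + Mpoly a u' -> h = h'.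
Proof.
move=> k0 hk lh h'k lh' uV u'V E; apply/eqP; rewrite -subr_eq0; apply/eqP.
apply: (ip1_eq0 Lge0 Lpos).
have {2}-> : h - h' = Mpoly a u' - Mpoly a u.
  by rewrite -(addrK (Mpoly a u) h) E; ring.
rewrite ip1Bl // !ip1Br // (ip1_harmonic_Mpoly k0 uV hk lh).
rewrite (ip1_harmonic_Mpoly k0 uV h'k lh') (ip1_harmonic_Mpoly k0 u'V hk lh).
by rewrite (ip1_harmonic_Mpoly k0 u'V h'k lh') !subrr.
Qed.

Lemma affineE f : (msize f <= 2)%N ->
  f = cst (mcoeff (@mnm0 d) f) + \sum_j cst (mcoeff (mnm1 j) f) * var j.
Proof.
move=> f2; apply/mpolyP => m; rewrite mcoeffD mcoeffC linear_sum /=.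
under eq_bigr do rewrite mcoeffCM mcoeffX.
have [m2|] := leqP 2 (mdeg m).
  have m0 : mdeg m != 0%N by rewrite -lt0n (leq_trans _ m2).
  rewrite (memN_msupp_eq0 (msize_mdeg_ge (leq_trans f2 m2))).
  rewrite -mdeg_eq0 (negbTE m0) mulr0 add0r big1 // => j _.
  by case: eqP => [mE|_]; rewrite ?mulr0 //; rewrite -mE mdeg1 in m2.
rewrite ltnS leq_eqVlt ltnS leqn0 => /orP[/mdeg1P[i /eqP ->]|].
  rewrite mnm1_eq0 mulr0 add0r (bigD1 i) //= eqxx mulr1 big1 ?addr0 // => j ji.
  by rewrite eq_mnm1 (negbTE ji) mulr0.
rewrite mdeg_eq0 => /eqP ->; rewrite eqxx mulr1 big1 ?addr0 // => j _.
by rewrite mnm1_eq0 mulr0.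
Qed.

(** The variables have mean zero for both weights, so both sides reduce to the constant term of
    [f]. *)
Lemma functional_rho_affine f : (msize f <= 2)%N -> L (rho * f) * L 1 = L f * L rho.
Proof.
have Lrv j : L (rho * var j) = 0.
  have := ibp_rho_mul Libp j 1; rewrite /rho_mul mderiv1 !mulr0 linear0 mulr1.
  have a2 : 0 < a + 1 + 1 by rewrite ltr_wpDr.
  by move=> /esym/eqP; rewrite !mulf_eq0 pnatr_eq0 (gt_eqF a2) /= => /eqP.
have sum0 (F : 'I_d -> poly) : (forall j, L (F j) = 0) -> L (\sum_j F j) = 0.
  by move=> F0; rewrite (linear_sum L) big1.
move=> /affineE ->; set c := mcoeff _ f.
rewrite mulrDr mulr_sumr (linearD L (rho * cst c)) (linearD L (cst c)) /= !sum0 => [|j|j].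
- have -> : L (cst c) = c * L 1 by rewrite -functional_cst mulr1.
  by rewrite [rho * _]mulrC functional_cst; ring.
- by rewrite functional_cst Lvar mulr0.
- by rewrite mulrCA functional_cst Lrv mulr0.
Qed.

Lemma ip1_cst p c : ip1 L p (cst c) = ip L p (cst c).
Proof.
rewrite /ip1 big1 ?add0r => [|i _]; last by rewrite mderivC /ip /cj rmorph0 mulr0 linear0.
have -> : ip L (cst c) 1 = c * ip L 1 1.
  by rewrite -functional_cst mul1r.
have -> : ip L p (cst c) = c^* * ip L p 1.
  by rewrite -functional_cst /ip cjC /cj rmorph1 mulr1 mulrC.
have N0 : ip L 1 1 != 0 by exact: ip11_neq0.
by rewrite rmorphM /= -(ipC Lcj 1 1); field.
Qed.

Lemma ip1_var p j : ip1 L p (var j) = L (mderiv j p).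
Proof.
have cj1 : cj 1 = 1 by rewrite /cj rmorph1.
have v1 : ip L (var j) 1 = 0 by rewrite /ip cj1 mulr1 Lvar.
rewrite /ip1 v1 rmorph0 mulr0 addr0 (bigD1 j) //= big1.
  by rewrite addr0 mderivXU eqxx mulr1n /ip cj1 mulr1.
by move=> i ij; rewrite mderivXU (negbTE ij) /ip /cj rmorph0 mulr0 linear0.
Qed.

(** Test polynomials are affine here. Against constants the two forms agree. Against [x_j] they give
    the means of [d_j p] and of [x_j p]; the rule [ibp] and [functional_rho_affine], applicable
    since [d_j p] is affine, show that these are nonzero multiples of each other. *)
Lemma V1_low n p : (n <= 2)%N -> V1 n p <-> orthpoly (ip L) n p.
Proof.
have L1 : L 1 != 0.
  apply/eqP => L10; suff /eqP : (1 : poly) = 0 by rewrite oner_eq0.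
  by apply: Lpos; rewrite /cj rmorph1 mulr1.
have Lrho : L rho != 0.
  apply/eqP => L10; suff /eqP : (1 : poly) = 0 by rewrite oner_eq0.
  by apply: Spos; rewrite /cj rmorph1 !mulr1.
have var_iff j : (msize p <= 3)%N -> ip1 L p (var j) = 0 <-> ip L p (var j) = 0.
  move=> p3; rewrite ip1_var /ip cjX mulrC.
  have := functional_rho_affine (msize_mderiv j p3); rewrite Libp => E.
  split=> [d0|x0].
    move/eqP: E; rewrite d0 mul0r !mulf_eq0 pnatr_eq0 (gt_eqF a1) (negbTE L1) orbF.
    by move/eqP.
  by move/esym/eqP: E; rewrite x0 mulr0 mul0r mulf_eq0 (negbTE Lrho) orbF => /eqP.
(* Stated for an arbitrary Hermitian form so as to serve both [ip1 L] and [ip L]. *)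
have expand (B : poly -> poly -> C) : (forall q r, B r q = (B q r)^*) ->
    (forall c q r s, B (c *: q + r) s = c * B q s + B r s) ->
    ((forall q, (msize q <= 2)%N -> B p q = 0) <->
     (forall c, B p (cst c) = 0) /\ (forall j, B p (var j) = 0)).
  move=> BC Bl; split=> [H|[H0 H1] q q2].
    split=> [c|j]; apply: H; last by rewrite msize_var.
    by rewrite msizeC (leq_trans (leq_b1 _)).
  rewrite (affineE q2) addrC BC //; elim: (index_enum _) => [|j s IH].
    by rewrite big_nil add0r -BC H0.
  by rewrite big_cons -addrA mul_mpolyC Bl rmorphD rmorphM /= IH -BC H1 mulr0 add0r.
have ip1E := expand (ip1 L) (ip1C Lcj) (ip1_linearl L).
have ipE := expand (ip L) (ipC Lcj) (ip_linearl L).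
case: n => [|[|[|//]]] _.
- by split=> -[pn _]; split=> // q; rewrite leqn0 msize_poly_eq0 => /eqP ->;
    rewrite -(mpolyC0 d C) ?ip1_cst /ip cjC rmorph0 mpolyC0 mulr0 linear0.
- by split=> -[pn po]; split=> // q q1; move: (po q q1);
    rewrite (msize1_polyC q1) ip1_cst.
split=> -[p3 po]; split=> //.
  move/ip1E: po => [c0 v0]; apply/ipE; split=> [c|j]; first by rewrite -ip1_cst.
  exact/(var_iff _ p3).
move/ipE: po => [c0 v0]; apply/ip1E; split=> [c|j]; first by rewrite ip1_cst.
exact/(var_iff _ p3).
Qed.

End Decomposition.
End Sobolev.

(** * Improper integrals on the line *)

Section ImproperFTC.
Context {R : realType}.
Local Notation mu := (@lebesgue_measure R).
Implicit Types (f F : R -> R) (a b : R).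

(** With [k.+3] the interval shortened by one step at each end is nondegenerate already for
    [k = 0]. *)
Definition step a b (k : nat) : R := (b - a) / k.+3%:R.

Definition inner_itv a b (k : nat) : set R :=
  `[a + step a b k, b - step a b k].

Lemma inner_itv_lt a b k : a < b ->
  a < a + step a b k < b - step a b k /\ b - step a b k < b.
Proof.
move=> ab; have e0 : 0 < step a b k by rewrite divr_gt0 // subr_gt0.
have e3 : step a b k <= (b - a) / 3.
  rewrite ler_pM2l ?subr_gt0 // lef_pV2 ?posrE ?ler_nat //.
by split; [apply/andP; split|]; lra.
Qed.

Lemma nondecreasing_inner_itv a b : a < b -> nondecreasing_seq (inner_itv a b).
Proof.
move=> ab m n mn; rewrite subsetEset => x; rewrite /inner_itv /= !in_itv /=.
have : step a b n <= step a b m.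
  by rewrite ler_pM2l ?subr_gt0 // lef_pV2 ?posrE ?ler_nat.
by move=> e /andP[? ?]; apply/andP; split; lra.
Qed.

Lemma bigcup_inner_itv a b : a < b -> \bigcup_k inner_itv a b k = `]a, b[%classic.
Proof.
move=> ab; apply/seteqP; split=> [x [k _]|x] /=; rewrite /inner_itv /= !in_itv /=.
  by have [/andP[? ?] ?] := inner_itv_lt k ab => /andP[? ?]; apply/andP; split; lra.
move=> /andP[ax xb]; pose e := Num.min (x - a) (b - x).
have e0 : 0 < e by rewrite lt_min !subr_gt0 ax.
exists (Num.bound ((b - a) / e)) => //=; rewrite /inner_itv /= in_itv /=.
set k := Num.bound _.
have ke : step a b k <= e.
  rewrite ler_pdivrMr ?ltr0n // mulrC -ler_pdivrMr //.
  have ba : 0 <= (b - a) / e by rewrite divr_ge0 ?ltW // subr_gt0.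
  rewrite ltW // (lt_le_trans (archi_boundP ba)) // ler_nat.
  by rewrite -addn3 leq_addr.
have : e <= x - a by rewrite ge_min lexx.
have : e <= b - x by rewrite ge_min lexx orbT.
by move=> ? ?; apply/andP; split; lra.
Qed.

Lemma cvg_inner_itv_step a b : step a b k @[k --> \oo] --> 0.
Proof.
rewrite -[X in _ --> X](mulr0 (b - a)); apply: cvgMr.
have := @cvg_harmonic R; rewrite -(cvg_shiftn 2) /=.
by apply: cvg_trans; apply: near_eq_cvg; near=> k; rewrite addn2.
Unshelve. all: by end_near. Qed.

Lemma cvg_inner_itvl a b : a < b -> (a + step a b k) @[k --> \oo] --> a^'+.
Proof.
move=> ab A aA.
have : (a + step a b k) @[k --> \oo] --> a.
  by rewrite -[X in _ --> X]addr0; apply: cvgD; [exact: cvg_cst|exact: cvg_inner_itv_step].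
move=> /(_ _ aA) uA; suff : \forall k \near \oo, A (a + step a b k) by [].
have {}uA : \forall k \near \oo, a < a + step a b k -> A (a + step a b k) := uA.
apply: filterS uA => k; apply.
by have [/andP[]] := inner_itv_lt k ab.
Qed.

Lemma cvg_inner_itvr a b : a < b -> (b - step a b k) @[k --> \oo] --> b^'-.
Proof.
move=> ab A bA.
have : (b - step a b k) @[k --> \oo] --> b.
  rewrite -[X in _ --> X]subr0; apply: cvgB; first exact: cvg_cst.
  exact: cvg_inner_itv_step.
move=> /(_ _ bA) uA; suff : \forall k \near \oo, A (b - step a b k) by [].
have {}uA : \forall k \near \oo, b - step a b k < b -> A (b - step a b k) := uA.
apply: filterS uA => k; apply.
by have [_] := inner_itv_lt k ab.
Qed.

Context (f F : R -> R) (a b : R).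
Hypotheses (ab : a < b) (fF : {in `]a, b[, forall x : R, is_derive x 1 F (f x)})
  (cf : {in `]a, b[, continuous f}).

Let sub_inner k : {subset `[a + step a b k, b - step a b k] <= `]a, b[}.
Proof.
have [/andP[? ?] ?] := inner_itv_lt k ab.
by move=> x; rewrite !in_itv /= => /andP[? ?]; apply/andP; split; lra.
Qed.

Lemma integral_inner_itv k : (\int[mu]_(x in inner_itv a b k) (f x)%:E =
  (F (b - step a b k))%:E - (F (a + step a b k))%:E)%E.
Proof.
have [/andP[au uv] vb] := inner_itv_lt k ab.
have dF x : x \in `[a + step a b k, b - step a b k] -> derivable F x 1.
  by move=> /sub_inner/fF[].
apply: continuous_FTC2 => //.
- apply: continuous_in_subspaceT => x; rewrite inE => /sub_inner; exact: cf.
- have := derivable_within_continuous dF.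
  move=> /(continuous_within_itvP _ uv)[_ Fl Fr]; split=> // x xuv.
  by apply: dF; exact: subset_itv_oo_cc xuv.
- move=> x /subset_itv_oo_cc/sub_inner/fF[_ <-]; exact: derive1E.
Qed.

Let mf : measurable_fun `]a, b[ f.
Proof.
apply: open_continuous_measurable_fun; first exact: interval_open.
by move=> x; rewrite inE; exact: cf.
Qed.

Let inner_sub k : inner_itv a b k `<=` `]a, b[.
Proof. by move=> x; exact: sub_inner. Qed.

(** Monotone convergence along the compact subintervals; integrability is not assumed, since this
    bound is what will provide it. *)
Lemma ge0_integral_oo_le (M : R) : (forall x, x \in `]a, b[ -> 0 <= f x) ->
  (forall u v, u \in `]a, b[ -> v \in `]a, b[ -> F v - F u <= M) ->
  (\int[mu]_(x in `]a, b[) (f x)%:E <= M%:E)%E.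
Proof.
move=> f0 FM; rewrite -(bigcup_inner_itv ab).
have cv : (\int[mu]_(x in inner_itv a b k) (f x)%:E)%E @[k --> \oo] -->
    (\int[mu]_(x in \bigcup_k inner_itv a b k) (f x)%:E)%E.
  apply: ge0_nondecreasing_set_cvg_integral.
  - exact: nondecreasing_inner_itv.
  - by move=> k; exact: measurable_itv.
  - by move=> k; apply/measurable_EFinP; exact: measurable_funS mf.
  - by move=> k x /inner_sub xab; rewrite lee_fin f0.
rewrite -(cvg_lim _ cv) //; apply: lime_le; first by apply/cvg_ex; eexists; exact: cv.
apply: nearW => k; rewrite integral_inner_itv -EFinB lee_fin.
have [/andP[? ?] ?] := inner_itv_lt k ab.
by apply: FM; rewrite in_itv /=; apply/andP; split; lra.
Qed.

(** Dominated convergence with [|f|] as the dominating function, the integrals over the compact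
    subintervals being increments of [F] that tend to zero. *)
Lemma integral_oo_eq0 : mu.-integrable `]a, b[ (EFin \o f) ->
  F x @[x --> a^'+] --> 0 -> F x @[x --> b^'-] --> 0 ->
  (\int[mu]_(x in `]a, b[) (f x)%:E = 0)%E.
Proof.
move=> intf Fa Fb.
have cv0 : (\int[mu]_(x in inner_itv a b k) (f x)%:E)%E @[k --> \oo] --> 0%E.
  under eq_cvg do rewrite integral_inner_itv -EFinB.
  apply: cvg_EFin; first exact: nearW.
  rewrite -[X in _ --> X](subr0 0); apply: cvgB.
    exact: (cvg_comp _ _ (cvg_inner_itvr ab) Fb).
  exact: (cvg_comp _ _ (cvg_inner_itvl ab) Fa).
have D : measurable (`]a, b[ : set (measurableTypeR R)) by exact: measurable_itv.
have mEf : measurable_fun `]a, b[ (EFin \o f) by exact/measurable_EFinP.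
have [] := @dominated_convergence _ _ R mu `]a, b[ D
  (fun k => (EFin \o f) \_ (inner_itv a b k)) (EFin \o f) (abse \o (EFin \o f)).
- move=> k; apply/(measurable_restrict _ _ _) => //; first exact: measurable_itv.
  by apply: measurable_funS mEf => //; exact: subIsetr.
- exact: mEf.
- apply: aeW => x xab; apply: cvg_near_cst.
  have : (\bigcup_k inner_itv a b k) x by rewrite bigcup_inner_itv.
  move=> [k0 _ k0x]; exists k0 => // k /= k0k.
  rewrite patchE mem_set //.
  by have /subsetPset := nondecreasing_inner_itv ab k0k; apply.
- exact: integrable_abse.
- apply: aeW => x k _; rewrite patchE; case: ifPn => _ //=.
  by rewrite normr0 lee_fin normr_ge0.
move=> _ _ cv; apply: (cvg_unique _ cv) => //.
apply: cvg_trans cv0; apply: near_eq_cvg; apply: nearW => k /=.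
rewrite -integral_mkcondr setIidr //; exact: inner_sub.
Qed.

End ImproperFTC.

(** * Integrals of truncated powers *)

Section TruncatedPower.
Context {R : realType}.
Local Notation mR := (measurableTypeR R).
Local Notation mu := (@lebesgue_measure R).
Implicit Types (a c s r : R).

(* Extending the weight by [0] turns integrals over the ball into integrals over
   the whole space, to which Fubini's theorem applies directly. *)
Definition tpow a c : R := if 0 < c then c `^ a else 0.

Lemma tpow_ge0 a c : 0 <= tpow a c.
Proof. by rewrite /tpow; case: ifP => // _; exact: powR_ge0. Qed.

Lemma measurable_tpow a : measurable_fun [set: R] (tpow a).
Proof.
apply: measurable_fun_ifT; [exact: measurable_fun_ltr|exact: measurable_powR|].
exact: measurable_cst.
Qed.

Lemma is_derive_powR_affine (e r b s : R) : 0 < r + e * s ->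
  is_derive s 1 (fun x => (r + e * x) `^ b) (e * (b * (r + e * s) `^ (b - 1))).
Proof.
move=> rs0.
have d1 : is_derive s 1 (fun x => r + e * x) e.
  by apply: is_derive_eq; rewrite add0r mul1r /GRing.scale /= mulr1.
have d2 := is_derive1_powR b rs0.
by rewrite mulrC; exact: (@is_derive1_comp _ (@powR R ^~ b) (fun x => r + e * x)).
Qed.

(** The exponent [a + 1/2] is that of the scaling [s = sqrt c * t]. One [K] serves all [c], because
    [c] will depend on the other coordinates. With [r = sqrt c]: for [a >= 0] the integrand is at
    most [r^(2 a)] on an interval of length [2 r]; for [a < 0] it is dominated by a function with an
    explicit primitive. *)
Lemma integral_tpow_le a : -1 < a -> exists2 K, 0 <= K &
  forall c, (\int[mu]_s (tpow a (c - s ^+ 2))%:E <= (K * tpow (a + 2^-1) c)%:E)%E.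
Proof.
move=> a1.
have [K K0 Kc] : exists2 K, 0 <= K & forall r, 0 < r ->
    (\int[mu]_(s in `](- r)%R, r[) (tpow a (r ^+ 2 - s ^+ 2))%:E
      <= (K * r `^ (2 * a + 1))%:E)%E.
  have mtpow r : measurable_fun [set: R] (fun s => tpow a (r ^+ 2 - s ^+ 2)).
    apply: measurableT_comp; first exact: measurable_tpow.
    by apply: measurable_funB => //; exact: measurable_funX.
  have r2E r s : 0 < r -> -r < s < r -> 0 < r ^+ 2 - s ^+ 2.
    by move=> r0 /andP[rs sr]; rewrite subr_sqr mulr_gt0; lra.
  have r2a r : 0 < r -> (r ^+ 2) `^ a * r = r `^ (2 * a + 1).
    move=> r0; rewrite powRD ?(gt_eqF r0) ?implybT // powRr1 ?(ltW r0) //.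
    by rewrite powRrM powR_mulrn // ltW.
  have [a0|a0] := leP 0 a.
    exists 2 => // r r0.
    apply: (@le_trans _ _ (\int[mu]_(s in `](- r)%R, r[) ((r ^+ 2) `^ a)%:E)%E).
      apply: ge0_le_integral => //=.
      - by move=> s _; rewrite lee_fin tpow_ge0.
      - by apply/measurable_EFinP; exact: measurable_funS (mtpow r).
      - move=> s; rewrite in_itv /= => sr; rewrite lee_fin /tpow r2E //.
        apply: ge0_ler_powR => //; rewrite ?nnegrE ?sqr_ge0 ?(ltW (r2E _ _ _ _)) //.
        by rewrite gerBl sqr_ge0.
    have muE : mu `](- r)%R, r[ = (2 * r)%:E.
      rewrite lebesgue_measure_itv /= lte_fin ifT; last lra.
      by rewrite -EFinB; congr EFin; ring.
    have -> : (\int[mu]_(s in `](- r)%R, r[) ((r ^+ 2) `^ a)%:E =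
        ((r ^+ 2) `^ a)%:E * (2 * r)%:E)%E.
      by rewrite -muE; apply: integral_cst; exact: measurable_itv.
    by rewrite -EFinM lee_fin -r2a // mulrCA.
  exists (2 * 2 `^ (a + 1) / (a + 1)); first by rewrite divr_ge0 ?mulr_ge0 ?powR_ge0; lra.
  move=> r r0.
  (* In [r^2 - s^2 = (r - s) (r + s)] one factor is at least [r], and its negative power is at most
     [r^a]. The other factor is [r - s] or [r + s] according to the sign of [s], and the sum covers
     both cases. *)
  pose f s := r `^ a * ((r + (-1) * s) `^ a + (r + 1 * s) `^ a).
  pose F s := r `^ a / (a + 1) * ((r + 1 * s) `^ (a + 1) - (r + (-1) * s) `^ (a + 1)).
  have dF : {in `]-r, r[, forall s : R, is_derive s 1 F (f s)}.
    move=> s; rewrite in_itv /= => /andP[rs sr].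
    have p1 : 0 < r + 1 * s by lra.
    have p2 : 0 < r + (-1) * s by lra.
    have d1 := is_derive_powR_affine (a + 1) p1.
    have d2 := is_derive_powR_affine (a + 1) p2.
    apply: is_derive_eq; rewrite /f /GRing.scale /= !addrK; field; lra.
  have cf : {in `]-r, r[, continuous f}.
    move=> s; rewrite in_itv /= => /andP[rs sr].
    have p1 : 0 < r + 1 * s by lra.
    have p2 : 0 < r + (-1) * s by lra.
    have d1 := is_derive_powR_affine a p1.
    have d2 := is_derive_powR_affine a p2.
    apply: differentiable_continuous; apply/derivable1_diffP.
    have : is_derive s (1 : R) f (r `^ a * ((-1) * (a * (r + (-1) * s) `^ (a - 1))
        + 1 * (a * (r + 1 * s) `^ (a - 1)))).
      by apply: is_derive_eq.
    by case.
  apply: (@le_trans _ _ (\int[mu]_(s in `](- r)%R, r[) (f s)%:E)%E).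
    apply: ge0_le_integral => //=.
    - by move=> s _; rewrite lee_fin tpow_ge0.
    - by apply/measurable_EFinP; exact: measurable_funS (mtpow r).
    - apply/measurable_EFinP; apply: open_continuous_measurable_fun => //.
      by move=> s; rewrite inE; exact: cf.
    - move=> s; rewrite in_itv /= => sr; rewrite lee_fin /tpow r2E //.
      have decr x y : 0 < x -> x <= y -> y `^ a <= x `^ a.
        move=> x0 xy; have y0 := lt_le_trans x0 xy.
        rewrite -[a]opprK !(powRN _ (- a)) lef_pV2 ?posrE ?powR_gt0 //.
        by apply: ge0_ler_powR; rewrite ?nnegrE ?oppr_ge0 // ltW.
      have -> : r ^+ 2 - s ^+ 2 = (r + (-1) * s) * (r + 1 * s) by ring.
      move: sr => /andP[rs sr].
      have p1 : 0 < r + 1 * s by lra.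
      have p2 : 0 < r + (-1) * s by lra.
      rewrite powRM ?(ltW p1) ?(ltW p2) // /f mulrDr.
      have [s0|s0] := leP 0 s.
        rewrite ler_wpDr ?mulr_ge0 ?powR_ge0 // mulrC ler_wpM2r ?powR_ge0 //.
        by apply: decr => //; lra.
      rewrite ler_wpDl ?mulr_ge0 ?powR_ge0 // ler_wpM2r ?powR_ge0 //.
      by apply: decr => //; lra.
  apply: (ge0_integral_oo_le _ dF cf); first lra.
    by move=> s _; rewrite /f mulr_ge0 ?addr_ge0 ?powR_ge0.
  move=> u v; rewrite !in_itv /= => /andP[ru ur] /andP[rv vr].
  have up x : 0 <= x -> x <= 2 * r -> x `^ (a + 1) <= 2 `^ (a + 1) * r `^ (a + 1).
    move=> x0 xr; rewrite -powRM ?(ltW r0) //.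
    by apply: ge0_ler_powR; rewrite ?nnegrE ?mulr_ge0 ?(ltW r0) //; lra.
  have -> : 2 * 2 `^ (a + 1) / (a + 1) * r `^ (2 * a + 1) =
      r `^ a / (a + 1) * (2 `^ (a + 1) * r `^ (a + 1) + 2 `^ (a + 1) * r `^ (a + 1)).
    have -> : r `^ (2 * a + 1) = r `^ a * r `^ (a + 1).
      by rewrite -powRD ?(gt_eqF r0) ?implybT //; congr (_ `^ _); ring.
    by ring.
  rewrite /F -mulrBr ler_wpM2l ?divr_ge0 ?powR_ge0 //; first lra.
  have h1 := up (r + 1 * v); have h2 := up (r + (-1) * u).
  have h3 := powR_ge0 (r + (-1) * v) (a + 1); have h4 := powR_ge0 (r + 1 * u) (a + 1).
  by rewrite opprB; apply: le_trans (_ : _ <= (r + 1 * v) `^ (a + 1)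
    + (r + (-1) * u) `^ (a + 1)) _; [lra|rewrite lerD ?h1 ?h2 //; lra].
exists K => // c; rewrite {2}/tpow; case: ltP => [c0|c0]; last first.
  rewrite mulr0 integral0_eq // => s _; rewrite /tpow ltNge subr_le0.
  by rewrite (le_trans c0 (sqr_ge0 _)).
have r0 : 0 < Num.sqrt c by rewrite sqrtr_gt0.
have -> : c `^ (a + 2^-1) = Num.sqrt c `^ (2 * a + 1).
  by rewrite -powR12_sqrt ?ltW // -powRrM; congr (_ `^ _); field.
apply: le_trans (Kc _ r0); rewrite integral_mkcond [leRHS]integral_mkcond.
rewrite le_eqVlt; apply/orP; left; apply/eqP; apply: eq_integral => s _.
rewrite patch_setT patchE sqr_sqrtr ?ltW //; case: ifPn => // /negP sr.
rewrite /tpow; case: ltP => // c_s; exfalso; apply: sr; rewrite inE /= in_itv /=.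
rewrite -ltr_norml -sqrtr_sqr ltr_sqrt //; lra.
Qed.

End TruncatedPower.

(** * Derivatives of polynomials times the weight *)

Section Lines.
Context {R : realType} {d : nat}.
Local Notation C := R[i].
Local Notation poly := (mpoly.mpoly d C).
Local Notation cst := (@mpoly.mpolyC d C).
Local Notation var i := (@mpoly.mpolyX d C (mpoly.mnm1 i)).
Local Notation Re := complex.Re.
Local Notation Im := complex.Im.
Implicit Types (p q : poly) (i j : 'I_d) (x : 'rV[R]_d) (s : R).

Lemma cReM (a b : C) : Re (a * b) = Re a * Re b - Im a * Im b.
Proof. by case: a; case: b. Qed.

Lemma cImM (a b : C) : Im (a * b) = Re a * Im b + Im a * Re b.
Proof. by case: a; case: b. Qed.

Lemma cReD (a b : C) : Re (a + b) = Re a + Re b.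
Proof. by case: a; case: b. Qed.

Lemma cImD (a b : C) : Im (a + b) = Im a + Im b.
Proof. by case: a; case: b. Qed.

Lemma complex_ext (a b : C) : Re a = Re b -> Im a = Im b -> a = b.
Proof. by case: a; case: b => ? ? ? ? /= -> ->. Qed.

Lemma cReZ (a : R) (b : C) : Re (a%:C%C * b) = a * Re b.
Proof. by rewrite cReM /= mul0r subr0. Qed.

Lemma cImZ (a : R) (b : C) : Im (a%:C%C * b) = a * Im b.
Proof. by rewrite cImM /= mul0r addr0. Qed.

(** Differentiability, boundedness on the ball, measurability, continuity and conjugation are all
    stable under sums and products, so this induction suits them better than one on monomials. *)
Lemma mpoly_ring_ind (Q : poly -> Prop) : (forall c, Q (cst c)) ->
  (forall j, Q (var j)) -> (forall p q, Q p -> Q q -> Q (p + q)) ->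
  (forall p q, Q p -> Q q -> Q (p * q)) -> forall p, Q p.
Proof.
move=> Qc Qv QD QM; elim/mpolyind => [|c m p _ _ Qp].
  by rewrite -(mpolyC0 d C).
apply: (QD) => //; rewrite -mul_mpolyC mpolyXE_id; apply: (QM) => //.
elim/big_ind: _ => [|? ? ? ?|j _]; [by rewrite -(mpolyC1 d C)|exact: QM|].
elim: (m j) => [|k IH]; first by rewrite expr0 -(mpolyC1 d C).
by rewrite exprS; exact: QM.
Qed.

Lemma pevalC c x : peval (cst c) x = c.
Proof. exact: mevalC. Qed.

Lemma pevalX j x : peval (var j) x = (x 0 j)%:C%C.
Proof. exact: mevalXU. Qed.

Lemma pevalD p q x : peval (p + q) x = peval p x + peval q x.
Proof. exact: mevalD. Qed.

Lemma pevalB p q x : peval (p - q) x = peval p x - peval q x.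
Proof. exact: mevalB. Qed.

Lemma pevalM p q x : peval (p * q) x = peval p x * peval q x.
Proof. exact: mevalM. Qed.

Lemma peval_sum (F : 'I_d -> poly) x : peval (\sum_j F j) x = \sum_j peval (F j) x.
Proof. by rewrite /peval raddf_sum. Qed.

Definition line x i s : 'rV[R]_d := \row_j (if j == i then s else x 0 j).

Lemma lineE x i s j : line x i s 0 j = if j == i then s else x 0 j.
Proof. by rewrite mxE. Qed.

Lemma line_id x i : line x i (x 0 i) = x.
Proof. by apply/rowP => j; rewrite lineE; case: eqP => // ->. Qed.

(** The two difference quotients coincide as functions, so partial derivatives reduce to
    one-variable calculus. *)
Lemma is_derive_along_line (f : 'rV[R]_d -> R) x i df :
  is_derive (x 0 i) (1 : R) (fun s => f (line x i s)) df ->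
  is_derive x (delta_mx 0 i) f df.
Proof.
move=> [ex dv].
have E : (fun h : R => h^-1 *: ((f \o shift x) (h *: delta_mx 0 i) - f x)) =
  (fun h : R => h^-1 *: (((fun s => f (line x i s)) \o shift (x 0 i)) (h *: (1 : R))
     - f (line x i (x 0 i)))).
  apply/funext => h /=; rewrite line_id; congr (_ *: (f _ - _)).
  apply/rowP => j; rewrite !mxE eqxx /= [h *: 1]mulr1.
  by case: eqP => [->|_]; rewrite ?mulr1 ?mulr0 ?add0r.
by apply: DeriveDef; [rewrite /derivable E|rewrite -dv /derive E].
Qed.

Lemma is_derive_peval_line p x i s :
  is_derive s (1 : R) (fun s => Re (peval p (line x i s)))
    (Re (peval (mderiv i p) (line x i s))) /\
  is_derive s (1 : R) (fun s => Im (peval p (line x i s)))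
    (Im (peval (mderiv i p) (line x i s))).
Proof.
elim/mpoly_ring_ind: p => [c|j|p q [dRp dIp] [dRq dIq]|p q [dRp dIp] [dRq dIq]].
- by rewrite mderivC -(mpolyC0 d C); split; under eq_fun do rewrite pevalC;
    rewrite pevalC; exact: is_derive_cst.
- rewrite mderivXU -(mpolyC_nat _ C) pevalC.
  split; under eq_fun do rewrite pevalX lineE /=; last first.
    by case: eqP => _ /=; exact: is_derive_cst.
  by rewrite eq_sym; case: eqP => _ /=; [exact: is_derive_id|exact: is_derive_cst].
- rewrite mderivD pevalD cReD cImD.
  split; under eq_fun do rewrite pevalD (cReD, cImD).
    exact: (is_deriveD dRp dRq).
  exact: (is_deriveD dIp dIq).
- rewrite mderivM pevalD !pevalM cReD cImD !cReM !cImM.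
  split.
    under eq_fun do rewrite pevalM cReM.
    apply: (is_derive_eq (is_deriveB (is_deriveM dRp dRq) (is_deriveM dIp dIq))).
    move: (Re (peval p _)) (Re (peval q _)) (Im (peval p _)) (Im (peval q _))
      (Re (peval (mderiv i p) _)) (Re (peval (mderiv i q) _))
      (Im (peval (mderiv i p) _)) (Im (peval (mderiv i q) _)) => *.
    by rewrite /GRing.scale /=; ring.
  under eq_fun do rewrite pevalM cImM.
  apply: (is_derive_eq (is_deriveD (is_deriveM dRp dIq) (is_deriveM dIp dRq))).
  move: (Re (peval p _)) (Re (peval q _)) (Im (peval p _)) (Im (peval q _))
    (Re (peval (mderiv i p) _)) (Re (peval (mderiv i q) _))
    (Im (peval (mderiv i p) _)) (Im (peval (mderiv i q) _)) => *.
  by rewrite /GRing.scale /=; ring.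
Qed.

Lemma partial_peval i p : partial i (peval p) = peval (mderiv i p).
Proof.
apply/funext => x; have [dR dI] := is_derive_peval_line p x i (x 0 i).
have [_ dR'] := @is_derive_along_line (fun y => Re (peval p y)) _ _ _ dR.
have [_ dI'] := @is_derive_along_line (fun y => Im (peval p y)) _ _ _ dI.
rewrite /partial dR' dI' line_id.
exact: (@complex_ext (_ +i* _)%C (peval (mderiv i p) x)).
Qed.

Lemma laplacian_peval p : laplacian (peval p) = peval (lap p).
Proof.
apply/funext => x; rewrite /laplacian /lap peval_sum.
by apply: eq_bigr => i _; rewrite !partial_peval.
Qed.

Definition nsq x : R := \sum_j x 0 j ^+ 2.

Lemma nsq_ge0 x : 0 <= nsq x.
Proof. by apply: sumr_ge0 => j _; exact: sqr_ge0. Qed.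

Lemma enorm_sqr x : enorm x ^+ 2 = nsq x.
Proof. by rewrite sqr_sqrtr // nsq_ge0. Qed.

Lemma weightE a x : weight a x = (1 - nsq x) `^ a.
Proof. by rewrite /weight enorm_sqr. Qed.

Lemma unit_ballE x : unit_ball x <-> 0 < 1 - nsq x.
Proof.
rewrite /unit_ball /= /enorm -/(nsq x) subr_gt0 -{1}[1]sqrtr1.
by rewrite ltr_sqrt // ltr01.
Qed.

Lemma nsq_line x i s : 1 - nsq (line x i s) = 1 - nsq x + x 0 i ^+ 2 - s ^+ 2.
Proof.
rewrite /nsq (bigD1 i) //= [in RHS](bigD1 i) //= lineE eqxx.
rewrite (eq_bigr (fun j => x 0 j ^+ 2)) => [|j /negbTE ji]; first by ring.
by rewrite lineE ji.
Qed.

Lemma peval_rho x : peval rho x = (1 - nsq x)%:C%C.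
Proof.
rewrite /rho /normsq pevalB peval_sum -(mpolyC1 d C) pevalC raddfB /= rmorph1.
congr (_ - _); rewrite /nsq raddf_sum; apply: eq_bigr => j _.
by rewrite pevalM pevalX -rmorphM.
Qed.

Lemma peval_wderiv (b : R) i p x : peval (wderiv b%:C%C i p) x =
  (1 - nsq x)%:C%C * peval (mderiv i p) x - (2 * b * x 0 i)%:C%C * peval p x.
Proof.
rewrite /wderiv pevalB !pevalM peval_rho pevalC pevalX.
by rewrite !rmorphM /= rmorph_nat; ring.
Qed.

Lemma is_derive_weight_line b p x i s : 0 < 1 - nsq (line x i s) ->
  is_derive s (1 : R) (fun s => weight b (line x i s) * Re (peval p (line x i s)))
    (weight (b - 1) (line x i s) * Re (peval (wderiv b%:C%C i p) (line x i s))) /\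
  is_derive s (1 : R) (fun s => weight b (line x i s) * Im (peval p (line x i s)))
    (weight (b - 1) (line x i s) * Im (peval (wderiv b%:C%C i p) (line x i s))).
Proof.
move=> ball_s; pose c := 1 - nsq x + x 0 i ^+ 2.
have ps : 0 < c - s ^+ 2 by rewrite -nsq_line.
have dw : is_derive s (1 : R) (fun s => weight b (line x i s))
    (- (2 * b * s) * weight (b - 1) (line x i s)).
  under eq_fun do rewrite weightE nsq_line.
  rewrite weightE nsq_line -/c.
  have d1 : is_derive s (1 : R) (fun s => c - s ^+ 2) (- (2 * s)).
    by apply: is_derive_eq; rewrite /GRing.scale /=; ring.
  have d2 := is_derive1_powR b ps.
  have := @is_derive1_comp _ (@powR R ^~ b) (fun s => c - s ^+ 2) _ _ _ d2 d1.
  by congr is_derive; ring.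
have [dR dI] := is_derive_peval_line p x i s.
have wE : weight b (line x i s) = weight (b - 1) (line x i s) * (c - s ^+ 2).
  rewrite !weightE nsq_line -/c -[X in _ * X]powRr1 ?ltW // -powRD ?subrK //.
  by rewrite (gt_eqF ps) implybT.
rewrite peval_wderiv cReD cImD -!mulNr -rmorphN !cReZ !cImZ nsq_line -/c lineE eqxx.
by split; apply: is_derive_eq; rewrite wE /GRing.scale /=; ring.
Qed.

Lemma partial_weight b i p x : unit_ball x ->
  partial i (fun y => (weight b y)%:C%C * peval p y) x =
  (weight (b - 1) x)%:C%C * peval (wderiv b%:C%C i p) x.
Proof.
move=> /unit_ballE bx; have := @is_derive_weight_line b p x i (x 0 i).
rewrite line_id => /(_ bx)[dR dI].
have [_ dR'] := @is_derive_along_line (fun y => weight b y * Re (peval p y)) _ _ _ dR.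
have [_ dI'] := @is_derive_along_line (fun y => weight b y * Im (peval p y)) _ _ _ dI.
rewrite /partial; under eq_fun do rewrite cReZ; rewrite dR'.
under eq_fun do rewrite cImZ; rewrite dI'.
by apply: complex_ext; rewrite /= ?(cReZ, cImZ).
Qed.

Lemma near_unit_ball_line x i : unit_ball x ->
  \forall s \near x 0 i, unit_ball (line x i s).
Proof.
move=> /unit_ballE bx; pose f s : R := 1 - nsq x + x 0 i ^+ 2 - s ^+ 2.
have cf : {for x 0 i, continuous f}.
  apply: differentiable_continuous; apply/derivable1_diffP.
  have : is_derive (x 0 i) (1 : R) f (- (2 * x 0 i)).
    by rewrite /f; apply: is_derive_eq; rewrite /GRing.scale /=; ring.
  by case.
have f0 : 0 < f (x 0 i) by rewrite /f addrK.
have f_gt0 : \forall s \near x 0 i, 0 < f s by exact: (cvgr_gt _ cf).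
by apply: filterS f_gt0 => s fs; apply/unit_ballE; rewrite nsq_line.
Qed.

(** [partial_weight] holds only inside the ball, so it can be differentiated once more only because
    the ball contains a neighbourhood of [x] on the line. *)
Lemma partial2_weight b i p x : unit_ball x ->
  partial i (partial i (fun y => (weight b y)%:C%C * peval p y)) x =
  (weight (b - 1 - 1) x)%:C%C *
    peval (wderiv (b - 1)%:C%C i (wderiv b%:C%C i p)) x.
Proof.
move=> bx; rewrite -partial_weight //.
pose F := partial i (fun y => (weight b y)%:C%C * peval p y); rewrite -/F.
pose G y := (weight (b - 1) y)%:C%C * peval (wderiv b%:C%C i p) y.
have FG : \forall s \near x 0 i, F (line x i s) = G (line x i s).
  by apply: filterS (near_unit_ball_line i bx) => s; exact: partial_weight.
have /unit_ballE bx' := bx.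
have := @is_derive_weight_line (b - 1) (wderiv b%:C%C i p) x i (x 0 i).
rewrite line_id => /(_ bx')[dR dI].
have dRF : is_derive (x 0 i) (1 : R) (fun s => Re (F (line x i s)))
    (weight (b - 1 - 1) x * Re (peval (wderiv (b - 1)%:C%C i (wderiv b%:C%C i p)) x)).
  apply: near_eq_is_derive dR.
  by apply: filterS FG => s ->; rewrite /G cReZ.
have dIF : is_derive (x 0 i) (1 : R) (fun s => Im (F (line x i s)))
    (weight (b - 1 - 1) x * Im (peval (wderiv (b - 1)%:C%C i (wderiv b%:C%C i p)) x)).
  apply: near_eq_is_derive dI.
  by apply: filterS FG => s ->; rewrite /G cImZ.
have [_ dR'] := @is_derive_along_line (fun y => Re (F y)) _ _ _ dRF.
have [_ dI'] := @is_derive_along_line (fun y => Im (F y)) _ _ _ dIF.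
rewrite [RHS]partial_weight // /partial dR' dI'.
by apply: complex_ext; rewrite /= ?(cReZ, cImZ).
Qed.

Lemma Mop_peval (a : R) p x : unit_ball x ->
  Mop a (peval p) x = peval (Mpoly a%:C%C p) x.
Proof.
move=> bx; rewrite /Mop /laplacian /Mpoly peval_sum mulr_sumr.
apply: eq_bigr => i _; rewrite partial2_weight // mulrA -rmorphM /=.
have -> : (1 + a) - 1 = a by ring.
have -> : a%:C%C + 1 = (1 + a)%:C%C by rewrite rmorphD addrC.
have /unit_ballE/gt_eqF bx0 := bx.
rewrite !weightE -powRD ?bx0 ?implybT // (_ : 1 - a + (a - 1) = 0); last ring.
by rewrite powRr0 mul1r.
Qed.

End Lines.

(** * The weighted integral on the ball *)

Section TupleIntegral.
Context {R : realType}.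
Local Notation mR := (measurableTypeR R).
Local Notation mu := (@lebesgue_measure R).

Lemma measurable_comp_tcons n (f : n.+1.-tuple mR -> \bar R) :
  measurable_fun setT f -> measurable_fun setT (f \o @tcons R n).
Proof. by move=> mf; exact: (measurableT_comp mf (@measurable_tcons R n)). Qed.

Lemma ge0_integral_tcons n (f : n.+1.-tuple mR -> \bar R) :
  measurable_fun setT f -> (forall t, 0 <= f t)%E ->
  (\int[lebesgue_tuple n.+1]_t f t =
   \int[lebesgue_tuple n]_y \int[mu]_x f (tcons (x, y)))%E.
Proof.
move=> mf f0; rewrite /= /cons_measure ge0_integral_pushforward //.
- rewrite preimage_setT; apply: (fubini_tonelli2 (f \o @tcons R n)) => [|x /=] //.
  exact: measurable_comp_tcons.
- exact: measurable_tcons.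
Qed.

Lemma integrable_tcons n (f : n.+1.-tuple mR -> \bar R) :
  (lebesgue_tuple n.+1).-integrable setT f ->
  (mu \x lebesgue_tuple n)%E.-integrable setT (f \o @tcons R n).
Proof.
move=> /integrableP[mf foo]; apply/integrableP; split.
  exact: measurable_comp_tcons.
move: foo; rewrite /= /cons_measure ge0_integral_pushforward ?preimage_setT //.
  exact: measurable_tcons.
exact: measurableT_comp.
Qed.

Lemma integral_tcons n (f : n.+1.-tuple mR -> \bar R) :
  (lebesgue_tuple n.+1).-integrable setT f ->
  (\int[lebesgue_tuple n.+1]_t f t =
   \int[(mu \x lebesgue_tuple n)]_z f (tcons z))%E.
Proof.
move=> intf; have mf := measurable_int _ intf.
rewrite /= /cons_measure integral_pushforward ?preimage_setT //.
  exact: measurable_tcons.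
exact: integrable_tcons.
Qed.

Definition tset n (i : 'I_n) (s : R) (t : n.-tuple mR) : n.-tuple mR :=
  [tuple if j == i then s else tnth t j | j < n].

Lemma tnth_tset n (i j : 'I_n) s (t : n.-tuple mR) :
  tnth (tset i s t) j = if j == i then s else tnth t j.
Proof. by rewrite tnth_mktuple. Qed.

Lemma tnth_tcons0 n x (y : n.-tuple mR) : tnth (tcons (x, y)) ord0 = x.
Proof. by []. Qed.

Lemma tnth_tconsS n x (y : n.-tuple mR) j : tnth (tcons (x, y)) (lift ord0 j) = tnth y j.
Proof. by rewrite !(tnth_nth 0). Qed.

Lemma tset_tcons0 n x s (y : n.-tuple mR) : tset ord0 s (tcons (x, y)) = tcons (s, y).
Proof.
apply: eq_from_tnth => j; rewrite tnth_tset.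
have [k ->|->] := unliftP ord0 j; last by rewrite eqxx !tnth_tcons0.
by rewrite eq_sym eq_liftF !tnth_tconsS.
Qed.

Lemma tset_tconsS n i x s (y : n.-tuple mR) :
  tset (lift ord0 i) s (tcons (x, y)) = tcons (x, tset i s y).
Proof.
apply: eq_from_tnth => j; rewrite tnth_tset.
have [k ->|->] := unliftP ord0 j; last by rewrite tnth_tcons0.
by rewrite (inj_eq lift_inj) !tnth_tconsS tnth_tset.
Qed.

(** Fubini's theorem by induction on the dimension: the first coordinate is integrated first if it
    is the direction [i], and last otherwise. *)
Lemma integral_lines_eq0 n (i : 'I_n) (f : n.-tuple mR -> \bar R) :
  (lebesgue_tuple n).-integrable setT f ->
  (forall t, \int[mu]_s f (tset i s t) = 0)%E ->
  (\int[lebesgue_tuple n]_t f t = 0)%E.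
Proof.
elim: n i f => [[]//|n IH] i f intf line0.
have intg := integrable_tcons intf; rewrite integral_tcons //.
have [j iE|iE] := unliftP ord0 i.
  rewrite -integral12_prod_meas1 //.
  have mF := measurable_fubini_F intg.
  (* The induction hypothesis requires an integrable slice, which Fubini's theorem grants only for
     almost every [x]. *)
  rewrite (ae_eq_integral (cst 0%E)) ?integral0 //.
  apply: filterS (ae_integrable1 intg) => x intx _ /=.
  apply: (IH j) => // y; rewrite -[RHS](line0 (tcons (x, y))) iE.
  by apply: eq_integral => s _; rewrite tset_tconsS.
rewrite -integral21_prod_meas1 // integral0_eq // => y _ /=.
rewrite -[RHS](line0 (tcons (0, y))) iE.
by apply: eq_integral => s _; rewrite tset_tcons0.
Qed.

Definition tsq n (t : n.-tuple mR) : R := \sum_j tnth t j ^+ 2.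

Lemma tsq_tcons n x (y : n.-tuple mR) : tsq (tcons (x, y)) = x ^+ 2 + tsq y.
Proof. by rewrite /tsq big_ord_recl; congr (_ + _); apply: eq_bigr => j _; rewrite tnth_tconsS. Qed.

Lemma measurable_tsq n : measurable_fun setT (@tsq n).
Proof.
apply: measurable_sum => j; apply: measurable_funX; exact: measurable_tnth.
Qed.

Lemma measurable_tpow_tsq n (a c : R) :
  measurable_fun setT (fun t : n.-tuple mR => tpow a (c - tsq t)).
Proof.
apply: (measurableT_comp (@measurable_tpow R a)).
by apply: measurable_funB => //; exact: measurable_tsq.
Qed.

(* Integrating out one coordinate raises the exponent by 1/2, so that the
   induction on the dimension stays within exponents [> -1]. *)
Lemma integral_tpow_tsq_lty n (a c : R) : -1 < a ->
  (\int[lebesgue_tuple n]_t (tpow a (c - tsq t))%:E < +oo)%E.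
Proof.
elim: n a c => [|n IH] a c a1.
  rewrite /= integral_dirac //; first by rewrite diracT mul1e ltry.
  by apply/measurable_EFinP; exact: measurable_tpow_tsq.
rewrite ge0_integral_tcons; last 2 first.
- by apply/measurable_EFinP; exact: measurable_tpow_tsq.
- by move=> t; rewrite lee_fin tpow_ge0.
have [K K0 intK] := integral_tpow_le a1.
apply: (@le_lt_trans _ _ (\int[lebesgue_tuple n]_y (K%:E * (tpow (a + 2^-1) (c - tsq y))%:E))%E).
  apply: ge0_le_integral => //.
  - by move=> y _; apply: integral_ge0 => x _; rewrite lee_fin tpow_ge0.
  - pose f (t : n.+1.-tuple mR) := (tpow a (c - tsq t))%:E.
    have mf : measurable_fun setT f.
      by apply/measurable_EFinP; exact: measurable_tpow_tsq.
    apply: (measurable_fun_fubini_tonelli_G (f \o @tcons R n)) => [|x /=].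
      exact: measurable_comp_tcons.
    by rewrite lee_fin tpow_ge0.
  - apply/measurable_EFinP; apply: measurable_funM => //.
    exact: measurable_tpow_tsq.
  - move=> y _; rewrite -EFinM; apply: le_trans (intK _); rewrite le_eqVlt.
    apply/orP; left; apply/eqP; apply: eq_integral => x _.
    by rewrite tsq_tcons opprD addrA addrAC.
rewrite ge0_integralZl_EFin //.
- by rewrite lte_mul_pinfty ?lee_fin // IH //; lra.
- by move=> y _; rewrite lee_fin tpow_ge0.
- by apply/measurable_EFinP; exact: measurable_tpow_tsq.
Qed.

End TupleIntegral.

Section LineIntegral.
Context {R : realType}.
Local Notation mu := (@lebesgue_measure R).
Context (a c K : R) (h h' : R -> R).
(** Chosen so that [(c - s^2)^a k(s)] is the derivative of [(c - s^2)^(a + 1) h(s)]. *)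
Let k (s : R) := (c - s ^+ 2) * h' s - 2 * (a + 1) * s * h s.
Hypotheses (a1 : -1 < a) (dh : forall s : R, is_derive s 1 h (h' s))
  (ck : continuous k) (kK : forall s : R, 0 < c - s ^+ 2 -> `|k s| <= K).

Lemma cvg_tpow_sqr (e : R) (r : R) : c = r ^+ 2 ->
  forall F : set_system R, Filter F -> (s @[s --> F] --> r) ->
  (\forall s \near F, 0 < c - s ^+ 2) ->
  (c - s ^+ 2) `^ (a + 1) @[s --> F] --> 0.
Proof.
move=> cr F FF sr Fc.
have cv : (c - s ^+ 2) @[s --> F] --> 0^'+.
  have cv0 : (c - s ^+ 2) @[s --> F] --> 0.
    rewrite -(subrr (r ^+ 2)) {1}cr.
    by apply: cvgB; [exact: cvg_cst|exact: (cvgM sr sr)].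
  move=> A A0; have {}cv0 : \forall s \near F, 0 < c - s ^+ 2 -> A (c - s ^+ 2) := cv0 _ A0.
  suff : \forall s \near F, A (c - s ^+ 2) by [].
  by apply: filterS2 cv0 Fc => s; exact.
have a10 : 0 < a + 1 by rewrite -ltrBlDr sub0r.
exact: (cvg_comp _ _ cv (powR_cvg0 a10)).
Qed.

(** The primitive tends to zero at both ends because [a + 1 > 0], while [k] bounded and [a > -1]
    make the derivative integrable. For [c <= 0] the truncated power is zero. *)
Lemma integral_line_eq0 : (\int[mu]_s (k s * tpow a (c - s ^+ 2))%:E = 0)%E.
Proof.
have [c0|c0] := leP c 0.
  rewrite integral0_eq // => s _; rewrite /tpow ltNge subr_le0.
  by rewrite (le_trans c0 (sqr_ge0 _)) /= mulr0.
pose r := Num.sqrt c.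
have r0 : 0 < r by rewrite sqrtr_gt0.
have cr : c = r ^+ 2 by rewrite sqr_sqrtr // ltW.
have in_oo (s : R) : (s \in `]-r, r[) = (0 < c - s ^+ 2).
  by rewrite in_itv /= -ltr_norml -sqrtr_sqr ltr_sqrt // subr_gt0.
pose f (s : R) : R := (c - s ^+ 2) `^ a * k s.
pose F (s : R) : R := (c - s ^+ 2) `^ (a + 1) * h s.
have -> : (\int[mu]_s (k s * tpow a (c - s ^+ 2))%:E =
    \int[mu]_(s in `](- r)%R, r[) (f s)%:E)%E.
  rewrite [RHS]integral_mkcond; apply: eq_integral => s _.
  rewrite patchE mem_setE in_oo /f /tpow.
  by case: ifP => // _; rewrite ?mulr0 // mulrC.
have dpow (b s : R) : 0 < c - s ^+ 2 ->
    is_derive s (1 : R) (fun s => (c - s ^+ 2) `^ b)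
      (b * (c - s ^+ 2) `^ (b - 1) * - (2 * s)).
  move=> sc.
  have d1 : is_derive s (1 : R) (fun s => c - s ^+ 2) (- (2 * s)).
    by apply: is_derive_eq; rewrite /GRing.scale /=; ring.
  exact: (@is_derive1_comp _ (@powR R ^~ b) (fun s => c - s ^+ 2) _ _ _ (is_derive1_powR b sc) d1).
have dF : {in `]-r, r[, forall s : R, is_derive s 1 F (f s)}.
  move=> s; rewrite in_oo => sc; have ds := dpow (a + 1) s sc.
  apply: is_derive_eq; rewrite /f /k /GRing.scale /= addrK.
  have -> : (c - s ^+ 2) `^ (a + 1) = (c - s ^+ 2) `^ a * (c - s ^+ 2).
    by rewrite powRD ?(gt_eqF sc) ?implybT // powRr1 // ltW.
  ring.
have cf : {in `]-r, r[, continuous f}.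
  move=> s; rewrite in_oo => sc; apply: cvgM; last exact: ck.
  suff : {for s, continuous (fun s : R => (c - s ^+ 2) `^ a : R)} by [].
  apply: differentiable_continuous; apply/derivable1_diffP.
  by case: (dpow a s sc).
have ch (s : R) : {for s, continuous h}.
  apply: differentiable_continuous; apply/derivable1_diffP.
  by case: (dh s).
apply: (integral_oo_eq0 _ dF cf); first lra.
- have mf : measurable_fun `](- r)%R, r[ f.
    apply: open_continuous_measurable_fun; first exact: interval_open.
    by move=> s; rewrite inE; exact: cf.
  have [M M0 intM] := integral_tpow_le a1.
  have K0 : 0 <= K.
    by have := @kK 0; rewrite expr0n subr0 => /(_ c0); apply: le_trans.
  have mt : measurable_fun [set: R] (fun s => tpow a (c - s ^+ 2)).
    apply: measurableT_comp; first exact: measurable_tpow.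
    by apply: measurable_funB => //; exact: measurable_funX.
  apply/integrableP; split; first exact/measurable_EFinP.
  apply: (@le_lt_trans _ _ (\int[mu]_(s in `](- r)%R, r[) (K%:E * (tpow a (c - s ^+ 2))%:E))%E).
    apply: ge0_le_integral => //=.
    + by apply/measurable_EFinP; apply: measurableT_comp.
    + apply/measurable_EFinP; apply: measurable_funM => //.
      exact: measurable_funS mt.
    + move=> s sr; have sc : 0 < c - s ^+ 2 by rewrite -in_oo.
      rewrite -EFinM lee_fin /f normrM ger0_norm ?powR_ge0 // mulrC.
      by rewrite /tpow sc ler_wpM2r ?powR_ge0 // kK.
  rewrite ge0_integralZl_EFin //.
  + rewrite lte_mul_pinfty ?lee_fin //.
    apply: le_lt_trans (le_lt_trans (intM c) (ltry _)).
    apply: ge0_subset_integral => //; first exact/measurable_EFinP.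
    by move=> s _; rewrite lee_fin tpow_ge0.
  + by move=> s _; rewrite lee_fin tpow_ge0.
  + by apply/measurable_EFinP; exact: measurable_funS mt.
- rewrite -[X in _ --> X](mul0r (h (- r))); apply: cvgM.
    apply: (@cvg_tpow_sqr 0 (- r)); rewrite ?sqrrN //; first exact: cvg_at_right_filter.
    near=> s; rewrite -in_oo in_itv /=; apply/andP; split; near: s.
      exact: nbhs_right_gt.
    by apply: nbhs_right_lt; lra.
  exact/cvg_at_right_filter/ch.
- rewrite -[X in _ --> X](mul0r (h r)); apply: cvgM.
    apply: (@cvg_tpow_sqr 0 r) => //; first exact: cvg_at_left_filter.
    near=> s; rewrite -in_oo in_itv /=; apply/andP; split; near: s.
      by apply: nbhs_left_gt; lra.
    exact: nbhs_left_lt.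
  exact/cvg_at_left_filter/ch.
Unshelve. all: by end_near. Qed.

End LineIntegral.

Section BallFunctional.
Context {R : realType} {d : nat}.
Local Notation mR := (measurableTypeR R).
Local Notation mu := (@lebesgue_measure R).
Local Notation lam := (@lebesgue_tuple R d).
Local Notation C := R[i].
Local Notation poly := (mpoly.mpoly d C).
Local Notation cst := (@mpoly.mpolyC d C).
Local Notation var i := (@mpoly.mpolyX d C (mpoly.mnm1 i)).
Local Notation Re := complex.Re.
Local Notation Im := complex.Im.
Implicit Types (p q : poly) (i j : 'I_d) (x : 'rV[R]_d) (t : d.-tuple mR) (a : R).

Lemma nsq_rvec t : nsq (rvec t) = tsq t.
Proof. by apply: eq_bigr => j _; rewrite mxE. Qed.

Lemma rvec_tset t i s : rvec (tset i s t) = line (rvec t) i s.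
Proof. by apply/rowP => j; rewrite !mxE tnth_tset. Qed.

Lemma peval_bounded p : exists2 K, 0 <= K & forall x, 0 < 1 - nsq x ->
  `|Re (peval p x)| <= K /\ `|Im (peval p x)| <= K.
Proof.
elim/(@mpoly_ring_ind R d): p => [c|j|p q [K K0 pK] [M M0 qM]|p q [K K0 pK] [M M0 qM]].
- exists (`|Re c| + `|Im c|); first by rewrite addr_ge0.
  by move=> x _; rewrite pevalC; split; rewrite ?lerDl ?lerDr.
- exists 1 => // x; rewrite subr_gt0 pevalX /= normr0; split=> //.
  rewrite -(@ler_pXn2r _ 2) ?nnegrE // expr1n real_normK ?num_real //.
  by apply: le_trans (ltW H); rewrite /nsq (bigD1 j) //= lerDl sumr_ge0 // => k _; exact: sqr_ge0.
- exists (K + M); first exact: addr_ge0.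
  move=> x bx; have [pR pI] := pK x bx; have [qR qI] := qM x bx.
  by rewrite pevalD cReD cImD; split; apply: le_trans (ler_normD _ _) _; exact: lerD.
- exists (K * M + K * M); first by rewrite addr_ge0 // mulr_ge0.
  move=> x bx; have [pR pI] := pK x bx; have [qR qI] := qM x bx.
  rewrite pevalM cReM cImM; split.
    by apply: le_trans (ler_normB _ _) _; rewrite !normrM lerD // ler_pM.
  by apply: le_trans (ler_normD _ _) _; rewrite !normrM lerD // ler_pM.
Qed.

Lemma measurable_peval p : measurable_fun setT (fun t => Re (peval p (rvec t))) /\
  measurable_fun setT (fun t => Im (peval p (rvec t))).
Proof.
elim/(@mpoly_ring_ind R d): p => [c|j|p q [pR pI] [qR qI]|p q [pR pI] [qR qI]].
- by split; under eq_fun do rewrite pevalC; exact: measurable_cst.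
- split; under eq_fun do rewrite pevalX mxE /=; first exact: measurable_tnth.
  exact: measurable_cst.
- by split; under eq_fun do rewrite pevalD (cReD, cImD); exact: measurable_funD.
- split; under eq_fun do rewrite pevalM (cReM, cImM).
    by apply: measurable_funB; exact: measurable_funM.
  by apply: measurable_funD; exact: measurable_funM.
Qed.

(** A bound on the open ball suffices, because the truncated weight vanishes elsewhere. *)
Definition tame (h : d.-tuple mR -> R) := measurable_fun setT h /\
  exists2 K, 0 <= K & forall t, 0 < 1 - tsq t -> `|h t| <= K.

Lemma tame_peval p :
  tame (fun t => Re (peval p (rvec t))) /\ tame (fun t => Im (peval p (rvec t))).
Proof.
have [mR mI] := measurable_peval p; have [K K0 pK] := peval_bounded p.
by split; split=> //; exists K => // t; rewrite -nsq_rvec => /pK[].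
Qed.

Lemma integrable_tame a h : -1 < a -> tame h ->
  lam.-integrable setT (fun t => (h t * tpow a (1 - tsq t))%:E).
Proof.
move=> a1 [mh [K K0 hK]]; have mt := @measurable_tpow_tsq R d a 1.
apply: (@le_integrable _ _ R lam _ measurableT _
   (fun t => (K%:E * (tpow a (1 - tsq t))%:E)%E)).
- by apply/measurable_EFinP; exact: measurable_funM.
- move=> t _; rewrite /= lee_fin !normrM (ger0_norm (tpow_ge0 _ _)) (ger0_norm K0).
  rewrite /tpow; case: ltP => ht; last by rewrite !mulr0.
  by rewrite ler_wpM2r ?powR_ge0 // hK.
- apply: integrableZl => //; apply/integrableP; split; first exact/measurable_EFinP.
  under eq_integral do rewrite gee0_abs ?lee_fin ?tpow_ge0 //.
  exact: integral_tpow_tsq_lty.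
Qed.

Definition Lre a h : R := \int[lam]_t (h t * tpow a (1 - tsq t)).

(** Three terms, as in the real part of [c p + q]: [Re c Re p - Im c Im p + Re q]. *)
Lemma Lre_lin a u v (g h k l : d.-tuple mR -> R) : -1 < a ->
  tame h -> tame k -> tame l -> (forall t, g t = u * h t + v * k t + l t) ->
  Lre a g = u * Lre a h + v * Lre a k + Lre a l.
Proof.
move=> a1 th tk tl gE.
have ih := integrable_tame a1 th; have ik := integrable_tame a1 tk.
have il := integrable_tame a1 tl.
have iuh := integrableZl measurableT u ih; have ivk := integrableZl measurableT v ik.
rewrite /Lre -(RintegralZl u measurableT ih) -(RintegralZl v measurableT ik).
rewrite -(RintegralD measurableT iuh ivk).
rewrite -(RintegralD measurableT (integrableD measurableT iuh ivk) il).
by apply: eq_Rintegral => t _; rewrite gE; ring.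
Qed.

Definition Lpoly a p : C :=
  (Lre a (fun t => Re (peval p (rvec t))) +i* Lre a (fun t => Im (peval p (rvec t))))%C.

Lemma integral_ball_weight a p :
  integral_ball (fun x => peval p x * (weight a x)%:C%C) = Lpoly a p.
Proof.
have E (h : d.-tuple mR -> R) :
    \int[lam]_(t in rvec @^-1` unit_ball) (weight a (rvec t) * h t) = Lre a h.
  rewrite /Lre [LHS]Rintegral_mkcond; apply: eq_Rintegral => t _.
  rewrite patchE weightE nsq_rvec /tpow; have bt := unit_ballE (rvec t).
  rewrite nsq_rvec in bt; case: ifPn => [|/negP]; rewrite inE /= => H.
    by rewrite ifT ?(mulrC (h t)) //; exact/bt.
  by rewrite ifF ?mulr0 //; apply/negP => /bt.
by rewrite /integral_ball; apply: complex_ext => /=; rewrite -E;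
  apply: eq_Rintegral => t _; rewrite mulrC (cReZ, cImZ).
Qed.

Section Functional.
Context (a : R) (a1 : -1 < a).

Fact Lpoly_is_linear : scalar (Lpoly a).
Proof.
move=> c p q; have [pR pI] := tame_peval p; have [qR qI] := tame_peval q.
have pE t : peval (c *: p + q) (rvec t) = c * peval p (rvec t) + peval q (rvec t).
  by rewrite pevalD -mul_mpolyC pevalM pevalC.
apply: complex_ext; rewrite ?(cReD, cImD, cReM, cImM) /=.
  rewrite -mulNr; apply: Lre_lin => // t; rewrite pE cReD cReM; ring.
by apply: Lre_lin => // t; rewrite pE cImD cImM; ring.
Qed.

Lemma peval_cj p x : peval (cj p) x = (peval p x)^*.
Proof.
elim/(@mpoly_ring_ind R d): p => [c|j|p q IHp IHq|p q IHp IHq].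
- by rewrite cjC !pevalC.
- by rewrite cjX pevalX; apply: complex_ext; rewrite /= ?oppr0.
- rewrite cjD !pevalD; apply: etrans (esym (rmorphD (@Num.conj C) _ _)).
  exact: (congr2 +%R IHp IHq).
- rewrite cjM !pevalM; apply: etrans (esym (rmorphM (@Num.conj C) _ _)).
  exact: (congr2 *%R IHp IHq).
Qed.

Lemma Lpoly_cj p : Lpoly a (cj p) = (Lpoly a p)^*.
Proof.
have [pR pI] := tame_peval p.
apply: complex_ext => /=.
  by congr (Lre a _); apply/funext => t; rewrite peval_cj; case: (peval p _).
set I := (fun t => Im (peval p (rvec t))) in pI *.
(* The sign [-1] is written [-2 + 0 + 1] to fit the shape of [Lre_lin]. *)
transitivity (-2 * Lre a I + 0 * Lre a I + Lre a I); last by ring.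
apply: Lre_lin => // t; rewrite /I peval_cj.
by case: (peval p (rvec t)) => x y /=; ring.
Qed.

Lemma Lpoly_rho p : Lpoly a (rho * p) = Lpoly (a + 1) p.
Proof.
have E (h : d.-tuple mR -> R) : Lre a (fun t => (1 - tsq t) * h t) = Lre (a + 1) h.
  apply: eq_Rintegral => t _; rewrite /tpow; case: ltP => t0; last by rewrite !mulr0.
  rewrite powRD ?(gt_eqF t0) ?implybT // powRr1 ?ltW //; ring.
apply: complex_ext => /=; rewrite -E; congr (Lre a _); apply/funext => t;
  by rewrite pevalM peval_rho nsq_rvec (cReZ, cImZ).
Qed.

Lemma Re_mul_conj (z : C) : Re (z * z^*) = Re z ^+ 2 + Im z ^+ 2 /\ Im (z * z^*) = 0.
Proof. by case: z => x y /=; split; ring. Qed.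

Lemma Lpoly_ge0 p : 0 <= Lpoly a (p * cj p).
Proof.
rewrite lecE /=; apply/andP; split.
  rewrite /Lre /Rintegral integral0_eq // => t _.
  by rewrite pevalM peval_cj (Re_mul_conj _).2 mul0r.
apply: Rintegral_ge0 => t _; rewrite pevalM peval_cj (Re_mul_conj _).1.
by rewrite mulr_ge0 ?tpow_ge0 // addr_ge0 // sqr_ge0.
Qed.

(** On a line in direction [i] the weight is [c - s^2] truncated, with [c] determined by the other
    coordinates, and [integral_line_eq0] applies. A line that misses the ball has [c <= 0]. *)
Lemma Lpoly_wderiv i p : Lpoly a (wderiv (a + 1)%:C%C i p) = 0.
Proof.
pose w := wderiv (a + 1)%:C%C i p.
have [wR wI] := tame_peval w; have [K K0 wK] := peval_bounded w.
have cont (q : poly) t s :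
    {for s, continuous (fun s : R => Re (peval q (line (rvec t) i s)) : R)} /\
    {for s, continuous (fun s : R => Im (peval q (line (rvec t) i s)) : R)}.
  have [dR dI] := is_derive_peval_line q (rvec t) i s.
  by split; apply: differentiable_continuous; apply/derivable1_diffP; [case: dR|case: dI].
have ER t s : Re (peval w (line (rvec t) i s)) =
    (1 - nsq (rvec t) + rvec t 0 i ^+ 2 - s ^+ 2) * Re (peval (mderiv i p) (line (rvec t) i s))
    - 2 * (a + 1) * s * Re (peval p (line (rvec t) i s)).
  by rewrite /w peval_wderiv cReD -mulNr -rmorphN !cReZ nsq_line lineE eqxx mulNr.
have EI t s : Im (peval w (line (rvec t) i s)) =
    (1 - nsq (rvec t) + rvec t 0 i ^+ 2 - s ^+ 2) * Im (peval (mderiv i p) (line (rvec t) i s))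
    - 2 * (a + 1) * s * Im (peval p (line (rvec t) i s)).
  by rewrite /w peval_wderiv cImD -mulNr -rmorphN !cImZ nsq_line lineE eqxx mulNr.
have R0 : Lre a (fun t => Re (peval w (rvec t))) = 0.
  rewrite /Lre /Rintegral (@integral_lines_eq0 R d i) //; first exact: integrable_tame.
  move=> t; under eq_integral do rewrite -nsq_rvec rvec_tset nsq_line ER.
  apply: (@integral_line_eq0 _ _ _ K) => // [s|s|s s0].
  - by have [] := is_derive_peval_line p (rvec t) i s.
  - under eq_fun do rewrite -ER; exact: (cont w t s).1.
  - by rewrite -ER; apply: (wK _ _).1; rewrite nsq_line.
have I0 : Lre a (fun t => Im (peval w (rvec t))) = 0.
  rewrite /Lre /Rintegral (@integral_lines_eq0 R d i) //; first exact: integrable_tame.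
  move=> t; under eq_integral do rewrite -nsq_rvec rvec_tset nsq_line EI.
  apply: (@integral_line_eq0 _ _ _ K) => // [s|s|s s0].
  - by have [] := is_derive_peval_line p (rvec t) i s.
  - under eq_fun do rewrite -EI; exact: (cont w t s).2.
  - by rewrite -EI; apply: (wK _ _).2; rewrite nsq_line.
exact: complex_ext.
Qed.

End Functional.
End BallFunctional.

(** * Positivity of the weighted integral *)

Lemma lebesgue_box_gt0 (R : realType) n (t0 : n.-tuple (measurableTypeR R)) (e : R) :
  0 < e -> exists B : set (n.-tuple (measurableTypeR R)), [/\ measurable B,
    (0 < lebesgue_tuple n B)%E & forall t, B t -> forall j, `|tnth t j - tnth t0 j| < e].
Proof.
move=> e0; elim: n t0 => [|n IH] t0.
  exists setT; split=> // [|t _ []//].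
  by rewrite /= /dirac_nil diracT lte01.
pose s0 : n.-tuple (measurableTypeR R) := [tuple of behead t0].
have [B [mB B0 Bs]] := IH s0.
pose I : set (measurableTypeR R) := `](thead t0 - e), (thead t0 + e)[%classic.
have mI : measurable I by exact: measurable_itv.
have I0 : (0 < lebesgue_measure I)%E.
  rewrite /I lebesgue_measure_itv /= lte_fin ifT; last lra.
  by rewrite -EFinB lte_fin; lra.
exists [set t | I (thead t) /\ B [tuple of behead t]]; split.
- apply: measurableI.
    by rewrite -[X in measurable X]setTI; apply: measurable_tnth.
  by rewrite -[X in measurable X]setTI; apply: measurable_behead.
- rewrite /= /cons_measure /pushforward.
  have -> : @tcons R n @^-1` [set t | I (thead t) /\ B [tuple of behead t]] = I `*` B.
    apply/seteqP; split=> -[x y] /=; rewrite theadE /=.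
      by rewrite (_ : [tuple of _] = y) //; apply: val_inj.
    by rewrite (_ : [tuple of _] = y) //; apply: val_inj.
  by rewrite product_measure1E // mule_gt0.
- move=> t [It Bt] j; have [k ->|->] := unliftP ord0 j.
    have := Bs _ Bt k; rewrite !(tnth_nth 0) /=.
    by case: t t0 {It Bt s0 IH Bs I mI I0} => [[|? ?] ?] [[|? ?] ?].
  move: It; rewrite /I /= in_itv /= /thead => /andP[? ?].
  by rewrite ltr_norml; apply/andP; split; lra.
Qed.

Section Positivity.
Context {R : realType} {d : nat}.
Local Notation mR := (measurableTypeR R).
Local Notation lam := (@lebesgue_tuple R d).
Local Notation C := R[i].
Local Notation poly := (mpoly.mpoly d C).
Local Notation cst := (@mpoly.mpolyC d C).
Local Notation var i := (@mpoly.mpolyX d C (mpoly.mnm1 i)).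
Local Notation Re := complex.Re.
Local Notation Im := complex.Im.
Implicit Types (p q : poly) (i j : 'I_d) (x : 'rV[R]_d) (t : d.-tuple mR) (a : R).

Lemma peval0 x : peval 0 x = 0.
Proof. exact: meval0. Qed.

(** The derivatives vanish on the ball as well and have smaller degree, so by induction they are
    zero; what remains is a constant, read off at the centre. *)
Lemma peval_eq0_ball p : (forall x, unit_ball x -> peval p x = 0) -> p = 0.
Proof.
have [k] := ubnP (msize p); elim: k p => // k IH p pk p0.
have dp0 i : mderiv i p = 0.
  have [->|pn0] := eqVneq p 0; first exact: mderiv0.
  apply: IH => [|x bx].
    have := msize_mderiv i (leqnn (msize p)).
    rewrite -ltnS prednK ?lt0n ?msize_poly_eq0 // => /leq_trans; apply.
    by rewrite -ltnS.
  rewrite -partial_peval.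
  have near0 : \forall s \near x 0 i, peval p (line x i s) = 0.
    by apply: filterS (near_unit_ball_line i bx) => s; exact: p0.
  have dR : is_derive (x 0 i) (1 : R) (fun s => Re (peval p (line x i s))) 0.
    apply: near_eq_is_derive (is_derive_cst 0 _ _).
    by apply: filterS near0 => s ->.
  have dI : is_derive (x 0 i) (1 : R) (fun s => Im (peval p (line x i s))) 0.
    apply: near_eq_is_derive (is_derive_cst 0 _ _).
    by apply: filterS near0 => s ->.
  have [_ dR'] := @is_derive_along_line _ _ (fun y => Re (peval p y)) _ _ _ dR.
  have [_ dI'] := @is_derive_along_line _ _ (fun y => Im (peval p y)) _ _ _ dI.
  by rewrite /partial dR' dI'.
rewrite (mderiv_eq0 dp0) in p0 *.
have b0 : unit_ball (0 : 'rV[R]_d).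
  by apply/unit_ballE; rewrite /nsq big1 ?subr0 // => j _; rewrite mxE expr0n.
by have := p0 0 b0; rewrite pevalC => ->; rewrite mpolyC0.
Qed.

Lemma continuous_peval p :
  continuous (fun x => Re (peval p x)) /\ continuous (fun x => Im (peval p x)).
Proof.
elim/(@mpoly_ring_ind R d): p => [c|j|p q [pR pI] [qR qI]|p q [pR pI] [qR qI]].
- by split; under eq_fun do rewrite pevalC; exact: cst_continuous.
- split; under eq_fun do rewrite pevalX /=; last exact: cst_continuous.
  exact: coord_continuous.
- split=> x; under eq_fun do rewrite pevalD (cReD, cImD).
    exact: (cvgD (pR x) (qR x)).
  exact: (cvgD (pI x) (qI x)).
- split=> x; under eq_fun do rewrite pevalM (cReM, cImM).
    exact: (cvgB (cvgM (pR x) (qR x)) (cvgM (pI x) (qI x))).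
  exact: (cvgD (cvgM (pR x) (qI x)) (cvgM (pI x) (qR x))).
Qed.

(** The integrand is nonnegative with zero integral, hence zero almost everywhere. A point of the
    ball where [p] is nonzero would give by continuity a box of positive measure where it is not. *)
Lemma Lpoly_eq0 a p : -1 < a -> Lpoly a (p * cj p) = 0 -> p = 0.
Proof.
move=> a1 /(congr1 (@complex.Re R)) /= L0; apply: peval_eq0_ball => x bx.
apply/eqP; apply: contraT => px0; exfalso.
pose g t := Re (peval (p * cj p) (rvec t)) * tpow a (1 - tsq t).
have [tR _] := tame_peval (p * cj p).
have ig : lam.-integrable setT (EFin \o g) := integrable_tame a1 tR.
have gE t : g t = (Re (peval p (rvec t)) ^+ 2 + Im (peval p (rvec t)) ^+ 2) * tpow a (1 - tsq t).
  by rewrite /g pevalM peval_cj (Re_mul_conj _).1.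
have g0 t : 0 <= g t by rewrite gE mulr_ge0 ?tpow_ge0 // addr_ge0 // sqr_ge0.
have : (\int[lam]_t `|(g t)%:E| = 0)%E.
  under eq_integral do rewrite gee0_abs ?lee_fin //.
  by rewrite -[LHS]fineK ?integrable_fin_num //; congr EFin.
move=> /(ae_eq_integral_abs _ measurableT (measurable_int _ ig)) [N [mN N0 gN]].
have nz : \forall y \near x, Re (peval p y) ^+ 2 + Im (peval p y) ^+ 2 != 0 /\
    0 < 1 - nsq y.
  have [cR cI] := continuous_peval p.
  have f0 : 0 < Re (peval p x) ^+ 2 + Im (peval p x) ^+ 2.
    rewrite lt_neqAle addr_ge0 ?sqr_ge0 // andbT eq_sym.
    apply: contra px0 => /eqP/(congr1 (real_complex R)).
    rewrite add_Re2_Im2 => /eqP; rewrite expf_eq0 normr_eq0 => /andP[_ /eqP ->].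
    exact: eqxx.
  have cf : (Re (peval p y) ^+ 2 + Im (peval p y) ^+ 2) @[y --> x] -->
      Re (peval p x) ^+ 2 + Im (peval p x) ^+ 2.
    exact: (cvgD (cvgM (cR x) (cR x)) (cvgM (cI x) (cI x))).
  have b0 : 0 < Re (peval rho x) by rewrite peval_rho; exact/unit_ballE.
  have cb := (continuous_peval rho).1 x.
  apply: filterS2 (cvgr_gt _ cf _ f0) (cvgr_gt _ cb _ b0) => y fy.
  by rewrite peval_rho gt_eqF.
(* The balls of the topology on row vectors are cubes, which is why a box is the right
   neighbourhood. *)
have /nbhs_ballP[e /= e0 eb] := nz.
have [B [mB B0 Be]] := lebesgue_box_gt0 [tuple x 0 j | j < d] e0.
have BN : B `<=` N.
  move=> t Bt; apply: gN => /= /(_ I); rewrite /= gE => -[] /eqP.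
  have [ne b] : Re (peval p (rvec t)) ^+ 2 + Im (peval p (rvec t)) ^+ 2 != 0 /\
    0 < 1 - nsq (rvec t).
    apply: eb; split=> // i j; rewrite /ball /= ord1 mxE distrC.
    by have := Be _ Bt j; rewrite tnth_mktuple.
  by rewrite mulf_eq0 (negbTE ne) -nsq_rvec /tpow b powR_eq0 gt_eqF.
move: B0; rewrite ltNge => /negP; apply.
by rewrite -N0; apply: le_measure; rewrite ?inE.
Qed.

End Positivity.

(** * The decomposition *)

Section Translation.
Context {R : realType} {d : nat}.
Local Notation C := R[i].
Local Notation poly := (mpoly.mpoly d C).
Local Notation cst := (@mpoly.mpolyC d C).
Local Notation var i := (@mpoly.mpolyX d C (mpoly.mnm1 i)).
Implicit Types (p q u : poly).
Context (a : R) (a1 : -1 < a).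

HB.instance Definition _ :=
  GRing.isLinear.Build C poly C *%R (@Lpoly R d a) (@Lpoly_is_linear R d a a1).

Local Notation L := (@Lpoly R d a : {scalar poly}).

Lemma ibp_Lpoly : ibp a%:C%C (Lpoly a : poly -> C).
Proof.
move=> i p; have := Lpoly_wderiv a1 i p.
rewrite /wderiv linearB /= (functional_cst L) rmorphD /= => /eqP.
by rewrite subr_eq0 => /eqP.
Qed.

Lemma addr1_complex_gt0 : 0 < a%:C%C + 1 :> C.
Proof. by rewrite ltcE /= addr0 eqxx -ltrBlDr sub0r. Qed.

Lemma inner_Lpoly b p q : inner b (peval p) (peval q) = ip (Lpoly b) p q.
Proof.
apply: etrans (integral_ball_weight b (p * cj q)).
congr integral_ball; apply/funext => x.
by rewrite pevalM peval_cj.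
Qed.

Lemma one_fun_peval : @Defs.one_fun R d = peval 1.
Proof. by apply/funext => x; rewrite -(mpolyC1 d C) pevalC. Qed.

Lemma inner1_Lpoly p q : inner1 a (peval p) (peval q) = ip1 L p q.
Proof.
rewrite /inner1 /ip1 one_fun_peval !inner_Lpoly; congr (_ + _).
by apply: eq_bigr => i _; rewrite !partial_peval inner_Lpoly.
Qed.

Lemma Pi_predP (n : nat) p : Pi (n%:Z - 1) p <-> (msize p <= n)%N.
Proof.
case: n => [|n].
  rewrite (_ : 0%:Z - 1 = Negz 0) // leqn0 msize_poly_eq0.
  by split=> [->|/eqP].
have -> : n.+1%:Z - 1 = n%:Z by rewrite -addn1 PoszD addrK.
by [].
Qed.

Lemma Vspace1E n p : Vspace1 a n p <-> orthpoly (ip1 L) n p.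
Proof.
split=> -[pn po]; split=> // q /Pi_predP qn.
  by rewrite -inner1_Lpoly po.
by rewrite inner1_Lpoly po //; exact/Pi_predP.
Qed.

Lemma VspaceE b n p : Vspace b n p <-> orthpoly (ip (Lpoly b)) n p.
Proof.
split=> -[pn po]; split=> // q /Pi_predP qn.
  by rewrite -inner_Lpoly po.
by rewrite inner_Lpoly po //; exact/Pi_predP.
Qed.


Lemma rho_mul_Lpoly : rho_mul (Lpoly a) = Lpoly (a + 1) :> (poly -> C).
Proof. by apply/funext => p; exact: Lpoly_rho. Qed.

Lemma HarmP n p : Harm n p <-> p \is ishomog1 n mdeg /\ lap p = 0.
Proof.
rewrite /Harm /= laplacian_peval; split=> -[hp lp]; split=> //.
  by apply: peval_eq0_ball => x _; exact: lp.
by move=> x; rewrite lp peval0.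
Qed.

Lemma MimageP (V : set poly) q : Mimage a V q <-> exists2 u, V u & q = Mpoly a%:C%C u.
Proof.
split=> -[u Vu uq]; exists u => //; last by move=> x bx; rewrite uq Mop_peval.
apply/eqP; rewrite -subr_eq0; apply/eqP/peval_eq0_ball => x bx.
by rewrite pevalB uq // Mop_peval // subrr.
Qed.

Let Lge0 p : 0 <= L (p * cj p). Proof. exact: Lpoly_ge0. Qed.
Let Lpos p : L (p * cj p) = 0 -> p = 0. Proof. exact: Lpoly_eq0. Qed.
Let Lcj p : L (cj p) = (L p)^*. Proof. exact: Lpoly_cj. Qed.
Let Spos p : L (rho * (p * cj p)) = 0 -> p = 0.
Proof. by rewrite /= Lpoly_rho //; apply: Lpoly_eq0; rewrite ltr_wpDr. Qed.

Lemma Vspace1_low n : (n <= 2)%N -> @Vspace1 R d a n = @Vspace R d a n.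
Proof.
move=> n2; apply/seteqP; split=> p.
  by move=> /Vspace1E/(V1_low addr1_complex_gt0 ibp_Lpoly Lcj Lpos Spos p n2)/VspaceE.
by move=> /VspaceE/(V1_low addr1_complex_gt0 ibp_Lpoly Lcj Lpos Spos p n2)/Vspace1E.
Qed.

Lemma Vspace1_high k : (0 < d)%N -> (0 < k)%N -> @orthogonal_direct_sum R d a
  (Vspace1 a k.+2) (Harm k.+2) (Mimage a (Vspace (a + 1) k)).
Proof.
move=> d0 k0; have a2 : -1 < a + 1 by rewrite ltr_wpDr.
have b1 := addr1_complex_gt0; have Libp := ibp_Lpoly.
have SE u : Vspace (a + 1) k u <-> orthpoly (ip (rho_mul L)) k u.
  by rewrite rho_mul_Lpoly; exact: VspaceE.
split.
- apply/seteqP; split=> p.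
    move=> /Vspace1E/(V1_decomposition b1 Libp Lcj Lge0 Lpos Spos d0 k0).
    move=> [h [u [hk lh uV ->]]]; exists h; first exact/HarmP.
    by exists (Mpoly a%:C%C u) => //; apply/MimageP; exists u => //; exact/SE.
  move=> [h /HarmP[hk lh] [q /MimageP[u /SE uV qE] <-]]; rewrite {q}qE.
  apply/Vspace1E; have hV : orthpoly (ip1 L) k.+2 h.
    exact: (V1_harmonic b1 Libp (isT : (0 < k.+2)%N) hk lh).
  (* The sum is written with differences only, so that [V1B] alone gives closure. *)
  have -> : h + Mpoly a%:C%C u = h - (h - h - Mpoly a%:C%C u) by ring.
  exact: (V1B hV (V1B (V1B hV hV) (V1_Mpoly b1 Libp k0 uV))).
- move=> h h' q q' /HarmP[hk lh] /HarmP[h'k lh'] /MimageP[u /SE uV ->] /MimageP[u' /SE u'V ->] E.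
  have hE := decomposition_uniq b1 Libp Lcj Lge0 Lpos k0 hk lh h'k lh' uV u'V E.
  by split; [exact: hE|move: E; rewrite hE => /addrI].
- move=> h q /HarmP[hk lh] /MimageP[u /SE uV ->]; rewrite inner1_Lpoly.
  exact: (ip1_harmonic_Mpoly b1 Libp Lcj k0 uV hk lh).
Qed.

End Translation.

Theorem lemma3p8 (R : realType) (d : nat) (alpha : R)
    (d_gt0 : (0 < d)%N) (alpha_gt : -1 < alpha) (n : nat) :
  ((n <= 2)%N -> @Vspace1 R d alpha n = @Vspace R d alpha n) /\
  ((3 <= n)%N ->
     @orthogonal_direct_sum R d alpha (Vspace1 alpha n)
       (Harm n) (Mimage alpha (Vspace (alpha + 1) (n - 2)%N))).
Proof.
split; first exact: Vspace1_low.
case: n => [|[|k]] // k0; rewrite subn2 /=.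
exact: Vspace1_high.
Qed.
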